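(* Let $X$ be a topological space, $\mathcal K$ be an ideal of compact Hausdorff subspaces of $X$, and $R$ be a topological ring which is either unconditionally seminormable or locally compact. Then the topological ring $C_{\mathcal K}(X,R)$ is unconditionally seminormable and Hirsch.
   Context: A topological ring is an Abelian topological group $R$ (written additively, identity $0$) endowed with a continuous associative binary operation which is distributive over addition on both sides (no unit and no commutativity of multiplication is assumed). It is locally compact if every element has a compact neighborhood. A family $\mathcal K$ of compact subsets of a topological space $X$ is an ideal of compact sets if for any $A,B\in\mathcal K$ and any closed subset $K\subseteq A\cup B$ we have $K\in\mathcal K$; it is an ideal of compact Hausdorff subspaces if moreover every member of $\mathcal K$ is a Hausdorff subspace of $X$. For topological spaces $X,Y$, $C_{\mathcal K}(X,Y)$ is the space of continuous functions from $X$ to $Y$ with the topology generated by the subbase of sets $[K;U]=\{f: f(K)\subseteq U\}$, where $K\in\mathcal K$ and $U\subseteq Y$ is open. $C_{\mathcal K}(X,R)$ carries the pointwise ring operations (it is a topological ring when $\mathcal K$ consists of compact Hausdorff subspaces). A seminorm on an Abelian topological group $G$ is a continuous function $\|\cdot\|:G\to[0,\infty)$ with $\|0\|=0$, $\|-x\|=\|x\|$ and $\|x+y\|\le\|x\|+\|y\|$ for all $x,y\in G$. A topological ring $R$ is unconditionally seminormable if for every neighborhood $U\subseteq R$ of $0$ there exist a seminorm $\|\cdot\|:R\to[0,\infty)$ on the additive group of $R$, a neighborhood $V\subseteq R$ of $0$, and positive real numbers $C,\varepsilon$ such that $\{x\in R:\|x\|<\varepsilon\}\subseteq U$ and for any finite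 set $F$ and sequences $(x_i)_{i\in F}\in R^F$ and $(a_i)_{i\in F}\in V^F$ with $M:=\max_{E\subseteq F}\|\sum_{i\in E}x_i\|\le\varepsilon$ we have $\|\sum_{i\in F}a_ix_i\|\le CM$. A series $\sum_{n\in\omega}x_n$ in an Abelian topological group $G$ unconditionally converges to $x\in G$ if for any neighborhood $U$ of $0$ there is a finite set $F\subset\omega$ such that $\sum_{i\in J}x_i\in x+U$ for any finite set $J\subset\omega$ containing $F$; it is unconditionally convergent if it unconditionally converges to some $x\in G$. A topological ring $R$ is Hirsch if for any unconditionally convergent series $\sum_{n\in\omega}x_n$ in $R$ and any neighborhood $U\subseteq R$ of $0$ there exists a neighborhood $V\subseteq R$ of $0$ such that $\sum_{n\in F}a_nx_n\in U$ for any finite set $F\subset\omega$ and any sequence $(a_n)_{n\in F}\in V^F$. *)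

(* Defs.v *)
From HB Require Import structures.
From mathcomp Require Import all_boot all_order all_algebra finmap.
From mathcomp Require Import all_classical all_reals all_analysis.

Set Implicit Arguments.
Unset Strict Implicit.
Unset Printing Implicit Defensive.

Import Order.TTheory GRing.Theory Num.Theory.
Import numFieldNormedType.Exports.

Local Open Scope classical_set_scope.
Local Open Scope ring_scope.

(* Topological rings, with neither a unit nor commutativity; MathComp's own
   ring structures all have a unit. *)
HB.mixin Record TopologicalZmodule_isTopologicalRng R
    & TopologicalZmodule R := {
  rngM : R -> R -> R ;
  rngMA : associative rngM ;
  rngMDl : left_distributive rngM +%R ;
  rngMDr : right_distributive rngM +%R ;
  rngM_continuous : continuous (fun x : R * R => rngM x.1 x.2) ;
}.

#[short(type="topologicalRngType")]
HB.structure Definition TopologicalRng :=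
  {R of TopologicalZmodule R & TopologicalZmodule_isTopologicalRng R}.

(* No closed or Hausdorff requirement, unlike MathComp-Analysis's
   [locally_compact], which asks for closed compact neighborhoods. *)
Definition locally_compact_space (X : topologicalType) :=
  forall x : X, exists2 C : set X, nbhs x C & compact C.

(* "Closed" is relative to the subspace A `|` B: when X is not Hausdorff, the
   compact set A `|` B need not be closed in X, and with "closed in X" the
   space of continuous functions below could fail to be a topological group. *)
Definition ideal_of_compact_sets (X : topologicalType) (K : set (set X)) :=
  (forall A, K A -> compact A) /\
  (forall A B L, K A -> K B -> L `<=` A `|` B ->
     closed (L : set (subspace (A `|` B))) -> K L).

(* [hausdorff_space A] is about the type of elements of [A], with its subspace
   topology. *)
Definition ideal_of_compact_Hausdorff_subspaces
    (X : topologicalType) (K : set (set X)) :=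
  ideal_of_compact_sets K /\ (forall A, K A -> hausdorff_space A).

Section Seminorms.
Variable Re : realType.

Definition is_seminorm (G : topologicalZmodType) (p : G -> Re) :=
  [/\ continuous p, (forall x, 0 <= p x), p 0 = 0,
      (forall x, p (- x) = p x) & (forall x y, p (x + y) <= p x + p y)].

Definition max_partial_norm (G : zmodType) (p : G -> Re) (F : finType)
    (x : F -> G) : Re :=
  \big[Num.max/0]_(E : {set F}) p (\sum_(i in E) x i).

Definition unconditionally_seminormable (R : topologicalRngType) :=
  forall U : set R, nbhs 0 U ->
  exists (p : R -> Re) (V : set R) (C e : Re),
    [/\ is_seminorm p, nbhs 0 V, 0 < C, 0 < e &
      [set x | p x < e] `<=` U /\
      forall (F : finType) (x a : F -> R), (forall i, V (a i)) ->
        max_partial_norm p x <= e ->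
        p (\sum_i rngM (a i) (x i)) <= C * max_partial_norm p x].

End Seminorms.

Definition unconditionally_converges_to (G : topologicalZmodType)
    (x : nat -> G) (l : G) :=
  forall U : set G, nbhs 0 U ->
  exists F : {fset nat}, forall J : {fset nat}, (F `<=` J)%fset ->
    U (\sum_(i <- J) x i - l).

Definition unconditionally_convergent (G : topologicalZmodType)
    (x : nat -> G) :=
  exists l, unconditionally_converges_to x l.

Definition Hirsch (R : topologicalRngType) :=
  forall x : nat -> R, unconditionally_convergent x ->
  forall U : set R, nbhs 0 U ->
  exists2 V : set R, nbhs 0 V &
    forall (F : {fset nat}) (a : nat -> R), (forall n, n \in F -> V (a n)) ->
      U (\sum_(n <- F) rngM (a n) (x n)).

(* The continuous functions from X to R with the topology generated by the
   sets [K; U].  The proof that K is an ideal of compact Hausdorff subspaces is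
   an argument because the topological ring structure depends on it. *)
Definition CK (X : topologicalType) (K : set (set X))
    (KH : ideal_of_compact_Hausdorff_subspaces K) (R : topologicalRngType) :
  Type := continuousType X R.

Section CK_theory.
Variables (X : topologicalType) (K : set (set X)).
Variables (KH : ideal_of_compact_Hausdorff_subspaces K).
Variable R : topologicalRngType.
Local Notation CKR := (CK KH R).

HB.instance Definition _ := Choice.copy CKR (continuousType X R).

Definition CK_mk (f : X -> R) (cf : continuous f) : CKR :=
  HB.pack_for (continuousType X R) f (isContinuous.Build _ _ f cf).

Lemma CK_ext (f g : CKR) : f =1 g -> f = g.
Proof. by move/continuousEP. Qed.

Lemma CK_continuous (f : CKR) : continuous f.
Proof. exact: cts_fun. Qed.

Lemma CK_zero_continuous : continuous (fun _ : X => 0 : R).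
Proof. by move=> x; exact: cvg_cst. Qed.

Lemma CK_op2_subproof (op : R -> R -> R) (f g : CKR) :
  continuous (fun x : R * R => op x.1 x.2) ->
  continuous (fun x => op (f x) (g x)).
Proof.
move=> cop x.
apply: (@continuous_comp _ _ _ (fun x => (f x, g x))
  (fun x : R * R => op x.1 x.2)); last exact: cop.
by apply: cvg_pair => /=; exact: CK_continuous.
Qed.

Lemma CK_opp_continuous (f : CKR) : continuous (fun x => - f x).
Proof.
move=> x; apply: (@continuous_comp _ _ _ f -%R).
  exact: CK_continuous.
exact: opp_continuous.
Qed.

Definition CK_zero : CKR := CK_mk CK_zero_continuous.
Definition CK_opp (f : CKR) : CKR := CK_mk (@CK_opp_continuous f).
Definition CK_add (f g : CKR) : CKR :=
  CK_mk (@CK_op2_subproof +%R f g add_continuous).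
Definition CK_mul (f g : CKR) : CKR :=
  CK_mk (@CK_op2_subproof rngM f g rngM_continuous).

Let CK_addA : associative CK_add.
Proof. by move=> f g h; apply: CK_ext => x; exact: addrA. Qed.
Let CK_addC : commutative CK_add.
Proof. by move=> f g; apply: CK_ext => x; exact: addrC. Qed.
Let CK_add0 : left_id CK_zero CK_add.
Proof. by move=> f; apply: CK_ext => x; exact: add0r. Qed.
Let CK_addN : left_inverse CK_zero CK_opp CK_add.
Proof. by move=> f; apply: CK_ext => x; exact: addNr. Qed.

HB.instance Definition _ :=
  GRing.isZmodule.Build CKR CK_addA CK_addC CK_add0 CK_addN.

HB.instance Definition _ := isSubBaseTopological.Build CKR
  [set KU : set X * set R | K KU.1 /\ open KU.2]
  (fun KU : set X * set R => [set f : CKR | f @` KU.1 `<=` KU.2]).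

Lemma CK_nbhs (f : CKR) (A : set X) (U : set R) :
  K A -> open U -> f @` A `<=` U -> nbhs f [set g : CKR | g @` A `<=` U].
Proof.
move=> KA oU fAU; exists [set g : CKR | g @` A `<=` U]; split => //.
exists [set [set g : CKR | g @` A `<=` U]]; last by rewrite bigcup_set1.
move=> _ ->; exists [fset (A, U)]%fset.
  by move=> i; rewrite !inE => /eqP ->; split.
rewrite eqEsubset; split=> g /=.
  by move=> gi; apply: (gi (A, U)); rewrite /= !inE.
by move=> gAU i; rewrite /= !inE => /eqP ->.
Qed.

Lemma CK_cvg (F : set_system CKR) (f : CKR) : Filter F ->
  (forall A U, K A -> open U -> f @` A `<=` U ->
    F [set g : CKR | g @` A `<=` U]) -> F --> f.
Proof.
move=> FF FAU W [B [[D DB <-] [i Di if_] BW]].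
apply: filterS BW _.
have [E ED Ei] := DB _ Di.
have : F i.
  rewrite -Ei; apply: filter_bigI => j jE.
  have /set_mem [KA oU] := ED _ jE.
  by apply: FAU => //; move: if_; rewrite -Ei; exact.
by apply: filterS => g ig; exists i.
Qed.

Lemma compact_set_type (A : set X) : compact A -> compact [set: A].
Proof.
move=> cA F PF _.
have [|x [Ax clx]] := cA (set_val @ F) (fmap_proper_filter _ PF).
  by apply: (@filterE _ F) => y; exact: set_valP.
exists (exist _ x (mem_set Ax)); split => // B C FB [_ [/= [W oW <-]] Wx WC].
have [||_ [[y By <-] Wy]] := clx (set_val @` B) W.
- by apply: (@filterS _ F) FB => y By; exists y.
- by apply: open_nbhs_nbhs; split.
by exists y; split => //; exact: WC.
Qed.

Lemma CK_regular (A W : set X) (x : X) : K A -> A x -> nbhs x W ->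
  exists L, [/\ K L, L `<=` W & \forall y \near x, A y -> L y].
Proof.
case: KH => -[Kc Kcl] Kh KA Ax xW.
pose a : A := exist _ x (mem_set Ax).
have cA := compact_set_type (Kc _ KA).
have aW : nbhs a (set_val @^-1` W).
  exact: (@initial_continuous A X set_val a).
have [D aD DW] := compact_regular (Kh _ KA) cA (@filterT _ (nbhs a) _) aW.
have [G oG GD] : open (~` closure D) by exact/closed_openC/closed_closure.
exists (set_val @` closure D); split.
- have LA : set_val @` closure D `<=` A by move=> _ [y _ <-]; exact: set_valP.
  apply: (Kcl A A) => //; rewrite setUid //.
  apply/closed_subspaceP; exists (~` G); first exact: open_closedC.
  rewrite (setIidl LA) eqEsubset; split=> [y [nGy Ay]|_ [y yD <-]].
    pose b : A := exist _ y (mem_set Ay).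
    exists b => //; apply: contrapT => nDb; apply: nGy.
    by have : (~` closure D) b by []; rewrite -GD.
  split; last exact: set_valP.
  by move=> Gy; have : (~` closure D) y by rewrite -GD.
- by move=> _ [y yD <-]; exact: DW.
- have [_ [[H oH <-] Ha HD]] := aD.
  apply: filterS (open_nbhs_nbhs (conj oH Ha)) => y Hy Ay.
  exists (exist _ y (mem_set Ay)) => //.
  by apply: subset_closure; exact: HD.
Qed.

Lemma CK_op2_continuous (op : R -> R -> R) (h : CKR -> CKR -> CKR) :
  (forall f g x, h f g x = op (f x) (g x)) ->
  continuous (fun x : R * R => op x.1 x.2) ->
  continuous (fun fg : CKR * CKR => h fg.1 fg.2).
Proof.
move=> hE cop [f g]; apply: CK_cvg => A U KA oU hAU.
have /compact_near_coveringP/near_covering_withinP cA : compact A.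
  by case: KH => -[Kc _] _; exact: Kc.
have /= := cA (CKR * CKR)%type (nbhs (f, g))
  (fun fg x => U (h fg.1 fg.2 x)) _ _.
move=> H; suff : \forall fg \near (f, g), A `<=` (fun x => U (h fg.1 fg.2 x)).
  by apply: filterS => fg AU _ [x Ax <-]; exact: AU.
apply: H => x Ax.
have : nbhs (f x, g x) [set z : R * R | U (op z.1 z.2)].
  apply: (cop (f x, g x)); apply: open_nbhs_nbhs; split=> //=.
  by rewrite -hE; apply: hAU; exists x.
case=> -[V W] /= [fV gW] VWU.
rewrite nbhsE in fV; case: fV => V' [oV' V'f V'V].
rewrite nbhsE in gW; case: gW => W' [oW' W'g W'W].
have xVW : nbhs x (f @^-1` V' `&` g @^-1` W').
  apply: filterI.
    exact: (@CK_continuous f x _ (open_nbhs_nbhs (conj oV' V'f))).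
  exact: (@CK_continuous g x _ (open_nbhs_nbhs (conj oW' W'g))).
have [L [KL LVW AL]] := CK_regular KA Ax xVW.
exists ((fun y => A y -> L y), [set fg : CKR * CKR |
  fg.1 @` L `<=` V' /\ fg.2 @` L `<=` W']) => /=.
  split=> //.
  exists ([set f' : CKR | f' @` L `<=` V'], [set g' : CKR | g' @` L `<=` W']).
    by split=> /=; apply: CK_nbhs => // _ [y Ly <-]; have [] := LVW _ Ly.
  by move=> [f' g'].
move=> [y [f' g']] /= [ALy [fL gL]] Ay; rewrite hE.
apply: (VWU (f' y, g' y)); split=> /=.
  by apply/V'V/fL; exists y => //; exact: ALy.
by apply/W'W/gL; exists y => //; exact: ALy.
Qed.

Let CK_sub_continuous : continuous (fun fg : CKR * CKR => fg.1 - fg.2).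
Proof.
apply: (@CK_op2_continuous (fun x y => x - y) (fun f g => f - g)) => //.
exact: sub_continuous.
Qed.

HB.instance Definition _ :=
  PreTopologicalNmodule_isTopologicalZmodule.Build CKR CK_sub_continuous.

Let CK_mulA : associative CK_mul.
Proof. by move=> f g h; apply: CK_ext => x; exact: rngMA. Qed.
Let CK_mulDl : left_distributive CK_mul +%R.
Proof. by move=> f g h; apply: CK_ext => x; exact: rngMDl. Qed.
Let CK_mulDr : right_distributive CK_mul +%R.
Proof. by move=> f g h; apply: CK_ext => x; exact: rngMDr. Qed.
Let CK_mul_continuous :
  continuous (fun fg : CKR * CKR => CK_mul fg.1 fg.2).
Proof.
apply: (@CK_op2_continuous rngM CK_mul) => //; exact: rngM_continuous.
Qed.

HB.instance Definition _ := TopologicalZmodule_isTopologicalRng.Build CKR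
  CK_mulA CK_mulDl CK_mulDr CK_mul_continuous.

End CK_theory.

(* Main.v *)
Require Import Defs.
From mathcomp Require Import all_boot all_order all_algebra.
From mathcomp Require Import finmap cyclic separable cyclotomic.
From mathcomp Require Import all_classical all_reals all_analysis.
From mathcomp Require Import ring lra zify.
From mathcomp.real_closed Require Import complex.

(** The heart of the matter is a locally compact ring R.  Let q be a continuous
    seminorm (Birkhoff-Kakutani) whose open unit ball W lies in a small compact
    set, and let H be the subgroup generated by W.  Finitely many elements span
    a discrete cocompact subgroup of H, and homogenizing the lattice coordinates
    gives finitely many additive maps theta_i on H whose l^1 norm s is bounded
    on W and has W-bounded unit ball.  For these,
    sum_j s(x_j) <= 2 n max_E s(sum_E x_j), and if a is close to 0 the multiples
    k (a x) stay small as long as k s(x) <= 1.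

    It remains to see that y_1 + ... + y_N is small when the multiples k y_j,
    k <= n_j, are small and sum_j 1/n_j <= 1/2.  Modulo the lattice H is totally
    bounded, hence approximated by the finite groups (Z/M)^d; there it is
    Bogolyubov's argument: every character in the large spectrum of the function
    max(0, 1 - q) moves y_j by at most 1/n_j, and hence the sum by at most 1/2.

    The passage to C_K(X, R) takes suprema over a compact set, and the Hirsch
    property follows by cutting an unconditionally convergent series into a
    finite head and a tail with uniformly small partial sums. *)

Set Implicit Arguments.
Unset Strict Implicit.
Unset Printing Implicit Defensive.
Import Order.TTheory GRing.Theory Num.Theory.
Import numFieldNormedType.Exports.
Local Open Scope classical_set_scope.
Local Open Scope ring_scope.

(** * Bogolyubov's argument on a finite group *)

Section UnitCircle.
Variable C : numClosedFieldType.

(** [X^n - 1] is separable, so it has [n] distinct roots, and such a list contains a primitive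
    one. *)
Lemma prim_root_ex (n : nat) : (0 < n)%N -> exists z : C, n.-primitive_root z.
Proof.
move=> n0; have [r] := closed_field_poly_normal ('X^n - 1 : {poly C}).
rewrite (monicP (monicXnsubC 1 n0)) scale1r => rE.
have /hasP[z _ nz] : has n.-primitive_root r.
  apply: has_prim_root => //.
  - by apply/allP => z zr; rewrite /root_of_unity rE root_prod_XsubC.
  - rewrite -separable_prod_XsubC -rE separable_Xn_sub_1 //.
    by rewrite pnatr_eq0 -lt0n.
  - by rewrite -ltnS -(size_prod_XsubC r id) -rE size_XnsubC.
by exists z.
Qed.

(* z^n - 1 = (z - 1) (1 + z + ... + z^(n-1)), and the second factor has norm
   at least n / 2. *)
Lemma norm_root_sub1 (z : C) (n : nat) : (0 < n)%N ->
  (forall k, (k <= n)%N -> `|z ^+ k - 1| <= 2^-1) -> `|z - 1| <= n%:R^-1.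
Proof.
move=> n0 zn; have n0' : 0 < n%:R :> C by rewrite ltr0n.
have sumE : \sum_(k < n) z ^+ k = n%:R + \sum_(k < n) (z ^+ k - 1).
  by rewrite big_split /= sumrN sumr_const card_ord addrCA subrr addr0.
have sum_ge : n%:R / 2 <= `|\sum_(k < n) z ^+ k|.
  rewrite sumE; apply: le_trans (lerB_normD _ _); rewrite normr_nat lerBrDr.
  have : `|\sum_(k < n) (z ^+ k - 1)| <= n%:R / 2.
    apply: le_trans (ler_norm_sum _ _ _) _.
    apply: (@le_trans _ _ (\sum_(k < n) 2^-1)).
      by apply: ler_sum => k _; apply: zn; exact: ltnW.
    by rewrite sumr_const card_ord [leRHS]mulrC mulr_natr.
  by move=> ?; rewrite [leRHS]splitr lerD2l.
have : `|z - 1| * (n%:R / 2) <= 2^-1.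
  apply: le_trans (ler_wpM2l (normr_ge0 _) sum_ge) _.
  by rewrite -normrM -subrX1; exact: zn.
rewrite mulrA ler_pdivrMr // mulVf ?pnatr_eq0 // => zn1.
by rewrite -[leRHS]div1r ler_pdivlMr.
Qed.

Lemma norm_prod_sub1 (I : finType) (z : I -> C) : (forall i, `|z i| = 1) ->
  `|\prod_i z i - 1| <= \sum_i `|z i - 1|.
Proof.
move=> z1; suff [] : `|\prod_i z i| = 1 /\
  `|\prod_i z i - 1| <= \sum_i `|z i - 1| by [].
elim/big_ind2 : _ => [|a x b y [x1 xa] [y1 yb]|i _]; last by split.
  by rewrite subrr normr0 normr1.
split=> /=; first by rewrite normrM x1 y1 mulr1.
have -> : x * y - 1 = x * (y - 1) + (x - 1) by ring.
by apply: le_trans (ler_normD _ _) _; rewrite normrM x1 mul1r addrC lerD.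
Qed.
End UnitCircle.

(** * Fourier analysis on the finite group [(Z/(n+2))^I] *)

Section Fourier.
Variables (C : numClosedFieldType) (n : nat) (I : finType) (z : C).
Hypothesis zP : n.+2.-primitive_root z.
Local Notation T := {ffun I -> 'I_n.+2}.

(** The pairing that identifies [T] with its dual group. The modulus [n.+2] is at least 2, so that
    ['I_n.+2] is a ring and 1 differs from 0. *)
Definition character (w a : T) : C := \prod_i z ^+ (w i * a i).
Local Notation chi := character.

Lemma characterC w a : chi w a = chi a w.
Proof. by apply: eq_bigr => i _; rewrite mulnC. Qed.

Lemma characterD w a b : chi w (a + b) = chi w a * chi w b.
Proof.
rewrite -big_split; apply: eq_bigr => i _ /=; rewrite ffunE /=.
rewrite -exprD -mulnDr; apply/eqP; rewrite (eq_prim_root_expr zP).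
by rewrite modnMmr.
Qed.

Lemma norm_character w a : `|chi w a| = 1.
Proof.
have z1 : `|z| = 1.
  apply/eqP; rewrite -(@pexpr_eq1 _ _ n.+2) // -normrX.
  by rewrite (prim_expr_order zP) normr1.
by rewrite normr_prod big1 // => i _; rewrite normrX z1 expr1n.
Qed.

Lemma character_neq0 w a : chi w a != 0.
Proof. by rewrite -normr_eq0 norm_character oner_eq0. Qed.

Lemma character0 w : chi w 0 = 1.
Proof.
by apply: (mulfI (character_neq0 w 0)); rewrite -characterD addr0 mulr1.
Qed.

Lemma characterN w a : chi w (- a) = (chi w a)^*.
Proof.
apply: (mulfI (character_neq0 w a)).
by rewrite -characterD subrr character0 -normCK norm_character expr1n.
Qed.

Lemma characterMn w a k : chi w (a *+ k) = chi w a ^+ k.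
Proof.
by elim: k => [|k IH]; rewrite ?character0 // mulrS exprS characterD IH.
Qed.

Lemma character_sum w (J : finType) (u : J -> T) :
  chi w (\sum_j u j) = \prod_j chi w (u j).
Proof.
elim/big_rec2 : _ => [|j x y _ <-]; first exact: character0.
exact: characterD.
Qed.

(** Orthogonality: shifting [w] by a basis vector at a coordinate where [a] does not vanish
    multiplies the sum by a number other than 1. *)
Lemma sum_character a : a != 0 -> \sum_w chi w a = 0.
Proof.
move=> /eqP a0; have /existsP[i ai0] : [exists i, a i != 0].
  apply: contra_notT a0; rewrite negb_exists => /forallP a0.
  by apply/ffunP => i; rewrite ffunE; apply/eqP; have := a0 i; rewrite negbK.
pose d : T := [ffun j => (j == i)%:R].
have chid : chi d a != 1.
  rewrite /chi (bigD1 i) //= big1 ?mulr1 => [|j /negPf ji]; last first.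
    by rewrite /d ffunE ji mul0n expr0.
  rewrite /d ffunE eqxx mul1n -[1](expr0 z) (eq_prim_root_expr zP) mod0n.
  by rewrite modn_small.
have : \sum_w chi w a = \sum_w chi w a * chi d a.
  rewrite (reindex_inj (addIr d)); apply: eq_bigr => w _.
  by rewrite characterC characterD ![chi a _]characterC.
rewrite -mulr_suml => /eqP; rewrite -subr_eq0 -[X in X - _]mulr1 -mulrBr.
by rewrite mulf_eq0 [1 - _ == 0]subr_eq0 [1 == _]eq_sym (negPf chid) orbF =>
  /eqP.
Qed.

Variable f : T -> C.
Hypothesis f01 : forall a, 0 <= f a <= 1.

Definition fourier w : C := \sum_a f a * chi w a.

Lemma conj_fourier w : (fourier w)^* = \sum_a f a * chi w (- a).
Proof.
rewrite rmorph_sum; apply: eq_bigr => a _ /=.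
by rewrite rmorphM /= characterN conj_Creal // ger0_real //;
  have /andP[] := f01 a.
Qed.

Lemma parseval_le : \sum_w `|fourier w| ^+ 2 <= #|{: T}|%:R ^+ 2.
Proof.
have -> : \sum_w `|fourier w| ^+ 2 = \sum_a f a * f a * #|{: T}|%:R.
  transitivity (\sum_w \sum_a \sum_b f a * f b * chi w (a - b)).
    apply: eq_bigr => w _; rewrite normCK conj_fourier mulr_suml.
    apply: eq_bigr => a _; rewrite mulr_sumr; apply: eq_bigr => b _.
    by rewrite characterD; ring.
  rewrite exchange_big; apply: eq_bigr => a _ /=.
  rewrite exchange_big (bigD1 a) //= [X in _ + X]big1 => [|b ba]; last first.
    rewrite -mulr_sumr sum_character ?mulr0 //.
    by rewrite subr_eq0 eq_sym.
  rewrite addr0 -mulr_sumr subrr; congr (_ * _).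
  under eq_bigr do rewrite character0.
  by rewrite sumr_const.
rewrite -mulr_suml expr2; apply: ler_wpM2r => //.
rewrite -[leRHS]sumr_const; apply: ler_sum => a _.
by have /andP[f0 f1] := f01 a; exact: mulr_ile1.
Qed.

(** After expansion of the fourth power, orthogonality leaves a multiple of the number of
    representations of [s] as [a + b - c - d], weighted by [f], and every weight is zero. *)
Lemma fourier4_eq0 s :
  (forall a b c d, s = a + b - c - d -> f a * f b * (f c * f d) = 0) ->
  \sum_w `|fourier w| ^+ 4 * chi w (- s) = 0.
Proof.
move=> fs.
transitivity (\sum_w \sum_(p : (T * T) * (T * T))
    f p.1.1 * f p.1.2 * (f p.2.1 * f p.2.2) *
    chi w (p.1.1 + p.1.2 - p.2.1 - p.2.2 - s)).
  apply: eq_bigr => w _.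
  rewrite (_ : `|fourier w| ^+ 4 = (fourier w * fourier w) *
      ((fourier w)^* * (fourier w)^*)); last first.
    by rewrite (exprM _ 2 2) normCK; ring.
  rewrite conj_fourier {1 2}/fourier big_distrlr [X in _ * X * _]big_distrlr /=.
  rewrite !pair_big big_distrlr pair_big /= mulr_suml.
  by apply: eq_bigr => -[[a b] [c d]] _ /=; rewrite !characterD; ring.
rewrite exchange_big big1 // => -[[a b] [c d]] _ /=; rewrite -mulr_sumr.
have [abcd|] := eqVneq (a + b - c - d) s; first by rewrite fs // mul0r.
by move=> ns; rewrite sum_character ?mulr0 // subr_eq0.
Qed.

Lemma fourier_shift (w u : T) :
  \sum_(a : T) f (a + u) * chi w a = chi w (- u) * fourier w.
Proof.
rewrite mulr_sumr [RHS](reindex_inj (addIr u)) /=; apply: eq_bigr => a _.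
rewrite characterD characterN.
have -> : (chi w u)^* * (f (a + u) * (chi w a * chi w u)) =
  f (a + u) * chi w a * (chi w u * (chi w u)^*) by ring.
by rewrite -normCK norm_character expr1n mulr1.
Qed.

(** Translating [f] by [u *+ k] multiplies its coefficient at [w] by [chi w (- u) ^+ k], but changes
    it by at most [mu ^+ 2 / 8] times the order of [T]. A coefficient more than twice that size
    forces the factor to be within 1/2 of 1. *)
Lemma fourier_large (w u : T) (k : nat) (mu : C) : 0 < mu ->
  (forall a, `|f (a + u *+ k) - f a| <= mu ^+ 2 / 8) ->
  mu ^+ 2 / 4 * #|{: T}|%:R < `|fourier w| -> `|chi w (- u) ^+ k - 1| <= 2^-1.
Proof.
move=> mu0 fu Fw.
have T0 : 0 < #|{: T}|%:R :> C by rewrite ltr0n; apply/card_gt0P; exists 0.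
have t0 : 0 < mu ^+ 2 / 4 * #|{: T}|%:R by rewrite mulr_gt0 // divr_gt0
  ?exprn_gt0 // ltr0n.
have F0 := lt_trans t0 Fw.
rewrite -(ler_pM2r F0) -normrM -characterMn mulNrn mulrBl mul1r -fourier_shift.
rewrite /fourier -sumrB; apply: le_trans (ler_norm_sum _ _ _) _.
apply: (@le_trans _ _ (2^-1 * (mu ^+ 2 / 4 * #|{: T}|%:R))); last first.
  by rewrite ler_wpM2l ?invr_ge0 //; exact: ltW.
rewrite (_ : 2^-1 * _ = mu ^+ 2 / 8 * #|{: T}|%:R); last by field.
rewrite mulr_natr -sumr_const; apply: ler_sum => a _.
by rewrite -mulrBl normrM norm_character mulr1.
Qed.

(* Bogolyubov's argument: if s were not in A + A - A - A for the support A of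
   f, the sum of |fourier w|^4 chi_w(-s) would vanish, although its terms with
   large |fourier w| have real part at least |fourier w|^4 / 2 and the others
   are negligible by Parseval. *)
Lemma bogolyubov (J : finType) (u : J -> T) (m : J -> nat) (mu : C) :
  0 < mu -> mu * #|{: T}|%:R <= \sum_a f a ->
  (forall j k a, (k <= m j)%N -> `|f (a + u j *+ k) - f a| <= mu ^+ 2 / 8) ->
  (forall j, (0 < m j)%N) -> \sum_j (m j)%:R^-1 <= 2^-1 :> C ->
  exists a b c d, \sum_j u j = a + b - c - d /\
    f a * f b * (f c * f d) != 0.
Proof.
move=> mu0 muf fu m0 sm; set s := \sum_j u j.
set N := #|{: T}|%:R : C in muf *.
have N0 : 0 < N by rewrite ltr0n; apply/card_gt0P; exists 0.
apply: contrapT => nex.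
have t0 : 0 < mu ^+ 2 / 4 * N by rewrite mulr_gt0 // divr_gt0 ?exprn_gt0 //
  ltr0n.
have : \sum_w `|fourier w| ^+ 4 * chi w (- s) = 0.
  apply: fourier4_eq0 => a b c d sE; apply/eqP; apply: contra_notT nex => abcd.
  by exists a, b, c, d.
set X := \sum_w `|fourier w| ^+ 4.
move=> X0; have XE : X = \sum_w `|fourier w| ^+ 4 * (1 - chi w (- s)).
  by under eq_bigr do rewrite mulrBr mulr1; rewrite sumrB X0 subr0.
have X_ge0 : 0 <= X by apply: sumr_ge0 => w _; rewrite exprn_ge0.
(* Where the coefficient is large, [1 - chi w (- s)] has norm at most 1/2, which accounts for
   [X / 2]. Elsewhere two of the four factors are bounded by the threshold and Parseval sums the
   other two. *)
have : X <= X / 2 + 2 * (mu ^+ 2 / 4 * N) ^+ 2 * N ^+ 2.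
  rewrite -[leLHS]ger0_norm // {1}XE.
  apply: le_trans (ler_norm_sum _ _ _) _.
  apply: (@le_trans _ _ (\sum_w (`|fourier w| ^+ 4 / 2 +
      2 * (mu ^+ 2 / 4 * N) ^+ 2 * `|fourier w| ^+ 2))); last first.
    rewrite big_split /= -mulr_suml -mulr_sumr lerD2l ler_wpM2l ?parseval_le //.
    by rewrite mulr_ge0 ?exprn_ge0 // ltW.
  apply: ler_sum => w _; rewrite normrM [X in X * _ <= _]ger0_norm ?exprn_ge0
    //.
  have tr : mu ^+ 2 / 4 * N \is Num.real.
    by rewrite ger0_real // ltW.
  have [Fw|Fw] := real_leP (normr_real (fourier w)) tr.
    apply: ler_wpDl; first by rewrite divr_ge0 ?exprn_ge0.
    have -> : 2 * (mu ^+ 2 / 4 * N) ^+ 2 * `|fourier w| ^+ 2 =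
      (mu ^+ 2 / 4 * N) ^+ 2 * `|fourier w| ^+ 2 * 2 by ring.
    rewrite (exprD _ 2 2); apply: ler_pM; rewrite ?mulr_ge0 ?exprn_ge0 //.
      apply: ler_wpM2r; first by rewrite exprn_ge0.
      by rewrite ler_pXn2r // nnegrE // ltW.
    by apply: le_trans (ler_normB _ _) _; rewrite normr1 norm_character.
  apply: ler_wpDr.
    by rewrite mulr_ge0 ?exprn_ge0 // mulr_ge0 ?exprn_ge0 // ltW.
  rewrite ler_wpM2l ?exprn_ge0 // distrC.
  rewrite /s -sumrN character_sum.
  apply: le_trans (norm_prod_sub1 _) _; first by move=> j;
    exact: norm_character.
  apply: le_trans sm; apply: ler_sum => j _; apply: norm_root_sub1 => // k km.
  by apply: (fourier_large mu0) Fw => a; exact: fu.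
(* The trivial character alone contributes at least four times what the previous bound allows for
   all of [X]. *)
have X4 : (mu * N) ^+ 4 <= X.
  rewrite /X (bigD1 (0 : T)) //=; apply: ler_wpDr.
    by apply: sumr_ge0 => w _; rewrite exprn_ge0.
  have F0 : fourier 0 = \sum_a f a.
    by apply: eq_bigr => a _; rewrite characterC character0 mulr1.
  have muN : 0 <= mu * N by rewrite mulr_ge0 // ltW.
  have F_ge0 : 0 <= fourier 0 by rewrite F0; exact: le_trans muf.
  by rewrite ger0_norm // F0 ler_pXn2r // nnegrE // -F0.
rewrite -subr_le0 opprD addrA {1}(splitr X) addrK subr_le0 => X2.
have XB : X <= (mu * N) ^+ 4 / 4.
  by move: X2; rewrite ler_pdivrMr //; congr (_ <= _); field.
have P0 : 0 < (mu * N) ^+ 4 by rewrite exprn_gt0 // mulr_gt0.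
have := le_trans X4 XB; rewrite ler_pdivlMr // -[X in _ <= X]mulr1.
by rewrite ler_pM2l // lern1.
Qed.
End Fourier.

(** * Seminorms on abelian groups *)

Section GroupSeminorm.
Variables (Re : realType) (G : zmodType).
Implicit Types (q : G -> Re) (x y : G).

Definition group_seminorm q :=
  [/\ q 0 = 0, forall x, q (- x) = q x & forall x y, q (x + y) <= q x + q y].

Section Theory.
Variable q : G -> Re.
Hypothesis qP : group_seminorm q.

Lemma seminorm0 : q 0 = 0. Proof. by case: qP. Qed.

Lemma seminormN x : q (- x) = q x. Proof. by case: qP. Qed.

Lemma seminormD x y : q (x + y) <= q x + q y. Proof. by case: qP. Qed.

Lemma seminormB x y : q (x - y) <= q x + q y.
Proof. by rewrite -(seminormN y) seminormD. Qed.

Lemma seminormBC x y : q (x - y) = q (y - x).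
Proof. by rewrite -seminormN opprB. Qed.

Lemma seminorm_ge0 x : 0 <= q x.
Proof.
by have := seminormB x x; rewrite subrr seminorm0; lra.
Qed.

Lemma seminorm_mulrn x n : q (x *+ n) <= n%:R * q x.
Proof.
elim: n => [|n IH]; first by rewrite seminorm0 mul0r.
by rewrite mulrS -natr1 mulrDl mul1r addrC (le_trans (seminormD _ _)) // lerD2r.
Qed.

Lemma seminorm_sum (J : Type) (s : seq J) (P : pred J) (y : J -> G) :
  q (\sum_(j <- s | P j) y j) <= \sum_(j <- s | P j) q (y j).
Proof.
elim/big_rec2: _ => [|j a b _ ab]; first by rewrite seminorm0.
by apply: le_trans (seminormD _ _) _; rewrite lerD2l.
Qed.

Lemma seminorm_le x y : q x <= q y + q (x - y).
Proof. by rewrite -{1}(subrK y x) addrC seminormD. Qed.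

Lemma seminorm_dist x y : `|q x - q y| <= q (x - y).
Proof.
rewrite ler_norml lerBlDl seminorm_le andbT lerBrDl lerBlDr.
by rewrite seminormBC seminorm_le.
Qed.

Lemma seminorm_scale (c : Re) : 0 <= c -> group_seminorm (fun x => c * q x).
Proof.
move=> c0; split=> [|x|x y]; rewrite ?seminorm0 ?mulr0 ?seminormN //.
by rewrite -mulrDr ler_wpM2l // seminormD.
Qed.
End Theory.

(** [A] is covered by balls with centres in [H]: compactness first yields centres anywhere, which
    are then moved into [A]. *)
Definition totally_bounded (A H : set G) q := forall e : Re, 0 < e ->
  exists (I : finType) (t : I -> G),
    (forall i, H (t i)) /\ forall x, A x -> exists i, q (x - t i) < e.

Definition subgroup (H : set G) := H 0 /\ forall x y, H x -> H y -> H (x - y).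

Section Subgroup.
Variable H : set G.
Hypothesis HP : subgroup H.

Lemma subgroup0 : H 0. Proof. by case: HP. Qed.

Lemma subgroupB x y : H x -> H y -> H (x - y). Proof. by case: HP => _;
  apply. Qed.

Lemma subgroupN x : H x -> H (- x).
Proof. by rewrite -sub0r; apply: subgroupB; exact: subgroup0. Qed.

Lemma subgroupD x y : H x -> H y -> H (x + y).
Proof. by move=> Hx Hy; rewrite -[y]opprK; apply: subgroupB => //;
  exact: subgroupN. Qed.

Lemma subgroup_mulrn x n : H x -> H (x *+ n).
Proof.
move=> Hx; elim: n => [|n IH]; first exact: subgroup0.
by rewrite mulrS; exact: subgroupD.
Qed.

Lemma subgroup_sum (J : Type) (s : seq J) (P : pred J) (y : J -> G) :
  (forall j, P j -> H (y j)) -> H (\sum_(j <- s | P j) y j).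
Proof.
by move=> Hy; elim/big_rec: _ => [|j a /Hy];
  [exact: subgroup0|exact: subgroupD].
Qed.
End Subgroup.

(** Here [P g w] makes [g] a generator of weight [w], and [cost P n x c] writes [x] as a chain of
    [n] generators of total weight [c]. *)
Inductive cost (P : G -> Re -> Prop) : nat -> G -> Re -> Prop :=
| cost0 : cost P 0 0 0
| costS n g w x c : P g w -> cost P n x c -> cost P n.+1 (g + x) (w + c).

(* The largest seminorm whose value at g is at most w whenever P g w. *)
Definition gauge (P : G -> Re -> Prop) x := inf [set c | exists n,
  cost P n x c].

Section Gauge.
Variable P : G -> Re -> Prop.
Hypothesis P_ge0 : forall g w, P g w -> 0 <= w.
Hypothesis PN : forall g w, P g w -> P (- g) w.
Hypothesis P_total : forall g, exists w, P g w.

Lemma cost_ge0 n x c : cost P n x c -> 0 <= c.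
Proof. by elim=> // {}n g w {}x {}c /P_ge0 w0 _ c0; exact: addr_ge0. Qed.

Lemma costD n m x y c d :
  cost P n x c -> cost P m y d -> cost P (n + m) (x + y) (c + d).
Proof.
move=> + yd; elim=> [|{}n g w {}x {}c Pg _ IH]; first by rewrite !add0r.
by rewrite addSn -!addrA; exact: costS.
Qed.

Lemma costN n x c : cost P n x c -> cost P n (- x) c.
Proof.
elim=> [|{}n g w {}x {}c Pg _ IH]; first by rewrite oppr0; exact: cost0.
by rewrite opprD; apply: costS => //; exact: PN.
Qed.

Lemma cost_generator g w : P g w -> cost P 1 g w.
Proof. by rewrite -{2}[g]addr0 -{2}[w]addr0 => Pg; apply: costS => //;
  exact: cost0. Qed.

Lemma gauge_le n x c : cost P n x c -> gauge P x <= c.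
Proof.
move=> xc; apply: ge_inf; last by exists n.
by exists 0 => d [m /cost_ge0].
Qed.

Lemma gauge_lt x c : gauge P x < c -> exists n d, cost P n x d /\ d < c.
Proof.
move=> /inf_lt[|d [n xd] dc]; last by exists n, d.
by have [w /cost_generator Pw] := P_total x; exists w, 1%N.
Qed.

Lemma gauge_seminorm : group_seminorm (gauge P).
Proof.
have gN x : gauge P (- x) <= gauge P x.
  rewrite leNgt; apply/negP => /gauge_lt[n [d [/costN/gauge_le xd dx]]].
  by have := le_lt_trans xd dx; rewrite ltxx.
split=> [|x|x y].
- apply/eqP; rewrite eq_le (gauge_le (cost0 P)) /=.
  apply: lb_le_inf; first by exists 0, 0%N; exact: cost0.
  by move=> d [n /cost_ge0].
- by apply/eqP; rewrite eq_le gN /= -{1}[x]opprK gN.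
- rewrite leNgt -subr_gt0; apply/negP => xy.
  set e := _ - _ in xy.
  have /gauge_lt[n [c [xc cx]]] : gauge P x < gauge P x + e / 2.
    by rewrite ltrDl divr_gt0.
  have /gauge_lt[m [d [yd dy]]] : gauge P y < gauge P y + e / 2.
    by rewrite ltrDl divr_gt0.
  have := gauge_le (costD xc yd); rewrite /e in cx dy; lra.
Qed.

(** The generator singled out is the one at which the running weight first exceeds [h]. With
    [h = c / 2] this drives the chain lemma of the Birkhoff-Kakutani theorem. *)
Lemma cost_split n x c (h : Re) : cost P n x c -> 0 <= h -> h < c ->
  exists n1 n2 x1 x2 g c1 c2 w,
    [/\ cost P n1 x1 c1, cost P n2 x2 c2, P g w & x = x1 + g + x2] /\
    [/\ (n1 < n)%N, (n2 < n)%N, c1 <= h, c2 <= c - h & w <= c].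
Proof.
move=> xc; elim: xc h => [|{}n g w {}x {}c Pg xc IH] h h0;
  first by rewrite ltNge h0.
have c_ge0 := cost_ge0 xc; have w_ge0 := P_ge0 Pg.
have [hw _|wh hc] := ltP h w.
  exists 0%N, n, 0, x, g, 0, c, w; rewrite add0r.
  split; split => //; [exact: cost0|lra|lra].
have [||n1 [n2 [x1 [x2 [g' [c1 [c2 [w' [[xc1 xc2 Pg' xE] [n1n n2n c1h c2c
  w'c]]]]]]]]]] :=
  IH (h - w); [lra|lra|].
exists n1.+1, n2, (g + x1), x2, g', (w + c1), c2, w'.
split; split => //; first exact: costS.
- by rewrite xE !addrA.
- by rewrite ltnW.
- lra.
- lra.
- lra.
Qed.
End Gauge.
End GroupSeminorm.

(** * Sums of progressions in totally bounded groups *)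

Section RealBogolyubov.
Variables (Re : realType) (n : nat) (I : finType).
Local Notation T := {ffun I -> 'I_n.+2}.

Lemma norm_real_complex (x : Re) : `|x%:C%C| = (`|x|)%:C%C.
Proof. by rewrite normc_def /= expr0n /= addr0 sqrtr_sqr. Qed.

Lemma real_bogolyubov (f : T -> Re) (J : finType) (u : J -> T)
    (m : J -> nat) (mu : Re) :
  (forall a, 0 <= f a <= 1) -> 0 < mu -> mu * #|{: T}|%:R <= \sum_a f a ->
  (forall j k a, (k <= m j)%N -> `|f (a + u j *+ k) - f a| <= mu ^+ 2 / 8) ->
  (forall j, (0 < m j)%N) -> \sum_j (m j)%:R^-1 <= 2^-1 :> Re ->
  exists a b c d, \sum_j u j = a + b - c - d /\
    [/\ f a != 0, f b != 0, f c != 0 & f d != 0].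
Proof.
move=> f01 mu0 muf fu m0 sm.
have [z zP] := prim_root_ex Re[i] (ltn0Sn n.+1).
have E (x : nat) : x%:R%:C%C = x%:R :> Re[i] by rewrite rmorph_nat.
have := @bogolyubov _ _ _ z zP (fun a => (f a)%:C%C) _ J u m mu%:C%C.
case.
- by move=> a; rewrite ler0c lecR; exact: f01.
- by rewrite ltcR.
- by rewrite -E -rmorphM -rmorph_sum lecR.
- move=> j k a km; rewrite -rmorphB norm_real_complex -(E 8) -rmorphXn
  -fmorph_div.
  by rewrite lecR fu.
- by [].
- rewrite -(E 2) -fmorphV (_ : \sum_j _ = (\sum_j (m j)%:R^-1)%:C%C) ?lecR //.
  by rewrite rmorph_sum; apply: eq_bigr => j _; rewrite -E fmorphV.
move=> a [b [c [d [-> abcd]]]]; exists a, b, c, d; split=> //.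
by move: abcd; rewrite -!rmorphM fmorph_eq0 !mulf_eq0 !negb_or =>
  /andP[/andP[? ?] /andP[? ?]].
Qed.
End RealBogolyubov.

Section Progressions.
Variables (Re : realType) (G : zmodType) (q : G -> Re) (H : set G).
Hypotheses (qP : group_seminorm q) (HP : subgroup H).
Hypothesis Hq : totally_bounded H H q.

(** Pigeonhole: two of the even multiples are close to the same net points for all [k] at once.
    Restricting to even multiples makes their difference at least 2, hence of the form [n.+2]. *)
Lemma common_period (K : finType) (g : K -> G) (e : Re) :
  (forall k, H (g k)) -> 0 < e -> exists n, forall k, q (g k *+ n.+2) < e.
Proof.
move=> Hg e0; have e20 : 0 < e / 2 by rewrite divr_gt0.
have [I [t [_ tP]]] := Hq e20.
have /choice[phi phiP] : forall j : nat, exists p : {ffun K -> I},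
    forall k, q (g k *+ j.*2 - t (p k)) < e / 2.
  move=> j; have /choice[p pP] : forall k, exists i,
    q (g k *+ j.*2 - t i) < e / 2.
    by move=> k; apply: tP; exact: subgroup_mulrn.
  by exists [ffun k => p k] => k; rewrite ffunE.
have [i [j [ij phiij]]] : exists i j : 'I_#|{: {ffun K -> I}}|.+1,
    (i < j)%N /\ phi i = phi j.
  apply: contrapT => nij.
  have /leq_card : injective (fun i : 'I_#|{: {ffun K -> I}}|.+1 => phi i).
    move=> i j phiij; apply/val_inj/eqP; apply: contrapT => /negP.
    by rewrite neq_ltn => /orP[ij|ji]; apply: nij; [exists i, j|exists j, i].
  by rewrite card_ord ltnn.
exists (j - i).*2.-2 => k.
have -> : ((j - i).*2.-2).+2 = (j.*2 - i.*2)%N.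
  by rewrite -doubleB; move: ij; rewrite -subn_gt0; case: (j - i)%N.
rewrite mulrnBr ?leq_double 1?ltnW //.
rewrite -(subrKA (t (phi j k))).
apply: le_lt_trans (seminormD qP _ _) _.
rewrite [X in _ + X](seminormBC qP) [ltRHS]splitr.
by rewrite ltrD // -phiij.
Qed.

Section Approximation.
Variables (K : finType) (g : K -> G) (n : nat) (e : Re).
Hypothesis ge : forall k, q (g k *+ n.+2) <= e.
Local Notation T := {ffun K -> 'I_n.+2}.

Definition combination (v : T) : G := \sum_k g k *+ v k.
Local Notation psi := combination.
Local Notation err := (#|K|%:R * e).

(** The defect consists of the carries: each coordinate that wraps around contributes one term
    [g k *+ n.+2], so [psi] is an approximate homomorphism. *)
Lemma combinationD a b : q (psi (a + b) - psi a - psi b) <= err.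
Proof.
have -> : psi (a + b) - psi a - psi b = - \sum_k g k *+ n.+2 *+ (n.+2 <= a k +
  b k)%N.
  rewrite /psi -!sumrB -sumrN; apply: eq_bigr => k _; rewrite ffunE.
  rewrite -addrA -opprD -mulrnDr -mulrnA; apply/eqP.
  rewrite subr_eq [X in _ == X]addrC eq_sym subr_eq -mulrnDr; apply/eqP;
    congr (_ *+ _) => /=.
  have an := ltn_ord (a k); have bn := ltn_ord (b k).
  case: leqP => ab; first by rewrite modn_small // muln0 addn0.
  rewrite muln1 -[in RHS](subnK ab) modnDr modn_small ?subnK //.
  by rewrite ltn_subLR // -addnS leq_add // ltnW.
rewrite seminormN //; apply: le_trans (seminorm_sum qP _ _ _) _.
rewrite mulr_natl -sumr_const; apply: ler_sum => k _.
case: leqP => _; last by rewrite mulr1n.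
by rewrite mulr0n seminorm0 // (le_trans _ (ge k)) // seminorm_ge0.
Qed.

Lemma combinationB a b : q (psi (a - b) - psi a + psi b) <= err.
Proof.
have := combinationD (a - b) b; rewrite subrK -(seminormN qP); congr (q _ <= _).
by rewrite opprD opprB opprK.
Qed.

Definition unit_vector (k : K) : T := [ffun j => (j == k)%:R].

Lemma combination_unit k : psi (unit_vector k) = g k.
Proof.
rewrite /psi (bigD1 k) //= big1 => [|j /negPf jk]; last by rewrite ffunE jk.
by rewrite ffunE eqxx addr0 /= modn_small.
Qed.

Lemma combination_shift a k m :
  q (psi (a + unit_vector k *+ m) - psi a - g k *+ m) <= m%:R * err.
Proof.
elim: m => [|m IH]; first by rewrite mulr0n addr0 subrr subr0 mul0r seminorm0.
have := combinationD (a + unit_vector k *+ m) (unit_vector k).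
rewrite combination_unit => h.
rewrite !mulrSr addrA mulrDl mul1r; apply: le_trans (lerD IH h).
apply: le_trans (seminormD qP _ _).
rewrite le_eqVlt; apply/orP; left; apply/eqP; congr (q _).
rewrite opprD -[X in X + (_ + _) = _](subrKA (psi (a + unit_vector k *+ m))).
by rewrite [RHS](AC (3*3) (4*5*(1*2)*3*6)) /= !addrA.
Qed.
End Approximation.

(* Approximating H by (Z/N)^K turns [1 - q] into a function on a finite group to
   which Bogolyubov's argument applies, with constants depending only on a
   1/4-net. *)
Lemma sum_progressions : exists2 d : Re, 0 < d &
  forall (J : finType) (y : J -> G) (m : J -> nat), (forall j, H (y j)) ->
    (forall j k, (k <= m j)%N -> q (y j *+ k) <= d) -> (forall j,
      (0 < m j)%N) ->
    \sum_j (m j)%:R^-1 <= 2^-1 :> Re -> q (\sum_j y j) < 5.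
Proof.
have q14 : 0 < 4^-1 :> Re by rewrite invr_gt0.
have [I [t [Ht tP]]] := Hq q14.
have [i0 _] := tP _ (subgroup0 HP).
have cI : 0 < #|I|%:R :> Re by rewrite ltr0n; apply/card_gt0P; exists i0.
(* At every point one of the [#|I|] translates of [f] by net points is at least 1/2, so [f] will
   have mean at least [mu]; [tau] is the variation that Bogolyubov's argument then tolerates. *)
pose mu : Re := (2 * #|I|%:R)^-1; pose tau := mu ^+ 2 / 8.
have mu0 : 0 < mu by rewrite invr_gt0 mulr_gt0.
have mu1 : mu <= 2^-1.
  rewrite lef_pV2 ?posrE ?mulr_gt0 // ler_peMr // ler1n -(ltr0n Re) //.
have tau0 : 0 < tau by rewrite divr_gt0 ?exprn_gt0.
have tau1 : tau <= 8^-1.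
  by rewrite ler_pdivrMr // mulVf // expr_le1 ?ltW // (le_lt_trans mu1) //
    invf_lt1 // ltr1n.
exists (tau / 2); first by rewrite divr_gt0.
move=> J y m Hy ym m0 sm.
(* [M] bounds every [m j], so the errors of up to [m j] additions in the finite group amount to at
   most [tau / 2]. *)
pose M := \sum_j m j; pose err : Re := tau / 2 / M.+1%:R.
have err0 : 0 < err by rewrite divr_gt0 ?ltr0Sn // divr_gt0.
have errM : M.+1%:R * err = tau / 2 by rewrite mulrC divfK.
have err1 : err <= tau / 2 by rewrite ler_pdivrMr // ler_peMr ?ler1n //
  divr_ge0 // ltW.
(* The net points join the [y j] as generators, so that the finite group contains translations by
   them. *)
pose K := (J + I)%type; pose g (k : K) := match k with inl j =>
  y j | inr i => t i end.
have Hg k : H (g k) by case: k.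
pose e := err / (#|{: K}|%:R + 1).
have e0 : 0 < e by rewrite divr_gt0 // ltr_wpDl.
have [n gn] := common_period Hg e0.
have {}gn k : q (g k *+ n.+2) <= e by exact/ltW/gn.
have Ke : #|{: K}|%:R * e <= err.
  rewrite /e mulrCA; apply: ler_piMr; first exact: ltW.
  by rewrite ler_pdivrMr ?mul1r ?lerDl // ltr_wpDl.
pose psi := @combination K g n.
pose T := {ffun K -> 'I_n.+2}.
pose u (k : K) : T := unit_vector n k.
have psiB (a b : T) : q (psi (a - b) - psi a + psi b) <= err.
  exact: le_trans (combinationB gn a b) Ke.
have psi_u k : psi (u k) = g k := combination_unit g n k.
pose f (a : T) : Re := Num.max 0 (1 - q (psi a)).
have f01 a : 0 <= f a <= 1.
  by rewrite /f le_max lexx /= ge_max ler01 /= gerBl seminorm_ge0.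
have f_dist a b : `|f a - f b| <= q (psi a - psi b).
  apply: le_trans (seminorm_dist qP _ _).
  rewrite /f ler_norml; move: (q (psi a)) (q (psi b)) => x z.
  by case: (leP 0 (1 - x)); case: (leP 0 (1 - z)); case: (ler0P (x - z)); lra.
have f_neq0 a : f a != 0 -> q (psi a) < 1.
  rewrite /f; case: (leP 0 (1 - q _)) => [q1 q2|_]; last by rewrite eqxx.
  by rewrite -subr_gt0 lt_def q2.
have muf : mu * #|{: T}|%:R <= \sum_a f a.
  rewrite /mu invfM -mulrA mulrCA ler_pdivrMl // mulr_natl mulr_natr.
  have -> : 2^-1 *+ #|{: T}| = \sum_(a : T) 2^-1 :> Re by rewrite sumr_const.
  have -> : (\sum_a f a) *+ #|I| = \sum_(i : I) \sum_(a : T) f (a - u (inr i)).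
    rewrite -sumr_const; apply: eq_bigr => i _.
    by rewrite [LHS](reindex_inj (addIr (- u (inr i)))).
  rewrite exchange_big; apply: ler_sum => a _ /=.
  have [|i qi] := tP (psi a).
    by apply: subgroup_sum => // k _; exact: subgroup_mulrn.
  rewrite (bigD1 i) //=; apply: ler_wpDr.
    by apply: sumr_ge0 => j _; have /andP[] := f01 (a - u (inr j)).
  rewrite /f le_max; apply/orP; right.
  have := psiB a (u (inr i)); rewrite psi_u /= -addrA.
  have := seminorm_le qP (psi (a - u (inr i))) (psi a - t i).
  rewrite opprB [- _ + _]addrC; lra.
have [j k a km|//|//|a [b [c [d [sE [fa fb fc fd]]]]]] :=
  @real_bogolyubov Re n K f J (fun j => u (inl j)) m mu f01 mu0 muf.
- apply: le_trans (f_dist _ _) _.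
  have := combination_shift gn a (inl j) k; rewrite -/psi -/(u _) /= => sh.
  have := ym j k km.
  have := seminormD qP (psi (a + u (inl j) *+ k) - psi a - y j *+ k) (y j *+ k).
  rewrite subrK.
  have : k%:R * (#|{: K}|%:R * e) <= tau / 2.
    rewrite -errM; apply: ler_pM => //; first by rewrite mulr_ge0 // ltW.
    by rewrite ler_nat (leq_trans km) // (leq_trans _ (leqnSn _)) // /M (bigD1
      j) //= leq_addr.
  by rewrite -/tau; lra.
(* The unit vectors are distinct, so no coordinate wraps around and [psi] is exact on their sum. *)
have -> : \sum_j y j = psi (\sum_j u (inl j)).
  rewrite /psi /combination big_sumType /= [X in _ + X]big1 => [|i _];
    last first.
    by rewrite sum_ffunE big1 // => j _; rewrite ffunE.
  rewrite addr0; apply: eq_bigr => j _;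
    rewrite sum_ffunE (bigD1 j) // big1 => [|l lj].
    by rewrite Monoid.mulm1 ffunE eqxx /= modn_small.
  by rewrite ffunE; case: eqP => // -[jl]; rewrite jl eqxx in lj.
have psiB_le (v w : T) : q (psi (v - w)) <= q (psi v) + q (psi w) + err.
  have := seminorm_le qP (psi (v - w)) (psi v - psi w).
  have := seminormB qP (psi v) (psi w).
  have := psiB v w; rewrite opprB [psi w - _]addrC addrA; lra.
have psiD_le (v w : T) : q (psi (v + w)) <= q (psi v) + q (psi w) + err.
  have := seminorm_le qP (psi (v + w)) (psi v + psi w).
  have := seminormD qP (psi v) (psi w).
  have := combinationD gn v w; rewrite -/psi opprD addrA; lra.
rewrite sE.
have := f_neq0 _ fa; have := f_neq0 _ fb; have := f_neq0 _ fc;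
  have := f_neq0 _ fd.
have := psiB_le (a + b - c) d; have := psiB_le (a + b) c; have := psiD_le a b.
lra.
Qed.
End Progressions.

(** * Locally precompact groups *)

Section Homogenization.
Variables (Re : realType) (G : zmodType) (H : set G) (u : G -> Re) (B : Re).
Hypothesis HP : subgroup H.
Hypothesis uD : forall x y, H x -> H y -> `|u (x + y) - u x - u y| <= B.

(** [theta x] is the limit of [u (x *+ 2 ^ k) / 2 ^+ k], taken as the supremum of the increasing
    lower bounds [a x k], which stay below the decreasing upper bounds [b x k]. *)
Lemma quasimorphism_homogenization : exists theta : G -> Re,
  (forall x y, H x -> H y -> theta (x + y) = theta x + theta y) /\
  (forall x, H x -> `|theta x - u x| <= B).
Proof.
have B0 : 0 <= B by have := uD (subgroup0 HP) (subgroup0 HP); apply: le_trans.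
pose a x k : Re := (u (x *+ 2 ^ k) - B) / 2 ^+ k.
pose b x k : Re := (u (x *+ 2 ^ k) + B) / 2 ^+ k.
have p2 k : 0 < 2 ^+ k :> Re by rewrite exprn_gt0.
have ab2 x k : H x -> a x k <= a x k.+1 /\ b x k.+1 <= b x k.
  move=> /(subgroup_mulrn HP (2 ^ k)) Hx; have := uD Hx Hx.
  rewrite /a /b -mulrnDr addnn -mul2n -expnS exprS invfM !mulrA ler_norml =>
    /andP[h1 h2].
  by rewrite !ler_pM2r ?invr_gt0 //; split; lra.
have ab x k : b x k = a x k + 2 * B / 2 ^+ k by rewrite /a /b; field;
  rewrite gt_eqF.
have amon x k j : H x -> a x k <= a x (k + j)%N.
  move=> Hx; elim: j => [|j IH]; first by rewrite addn0.
  by rewrite addnS (le_trans IH) //; case: (ab2 x (k + j)%N Hx).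
have bmon x k j : H x -> b x (k + j)%N <= b x k.
  move=> Hx; elim: j => [|j IH]; first by rewrite addn0.
  by rewrite addnS (le_trans _ IH) //; case: (ab2 x (k + j)%N Hx).
have aleb x k j : H x -> a x k <= b x j.
  move=> Hx; apply: le_trans (amon x k j Hx) _; rewrite addnC.
  apply: le_trans (bmon x j k Hx); rewrite ab lerDl.
  by rewrite divr_ge0 ?mulr_ge0 ?(ltW (p2 _)).
pose theta x := sup (range (a x)).
have atheta x k : H x -> a x k <= theta x.
  move=> Hx; apply: ub_le_sup; last by exists k.
  by exists (b x 0%N) => _ [j _ <-]; exact: aleb.
have thetab x k : H x -> theta x <= b x k.
  move=> Hx; apply: ge_sup; first by exists (a x 0%N), 0%N.
  by move=> _ [j _ <-]; exact: aleb.
exists theta; split=> [x y Hx Hy|x Hx]; last first.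
  have := atheta x 0%N Hx; have := thetab x 0%N Hx.
  rewrite /a /b expr0 expn0 mulr1n !divr1 ler_norml => h1 h2; apply/andP;
    split; lra.
have Hxy := subgroupD HP Hx Hy.
have small k : `|theta (x + y) - theta x - theta y| * 2 ^+ k <= 7 * B.
  rewrite -ler_pdivlMr //.
  have := atheta x k Hx; have := atheta y k Hy; have := atheta _ k Hxy.
  have := thetab x k Hx; have := thetab y k Hy; have := thetab _ k Hxy.
  have := uD (subgroup_mulrn HP (2 ^ k) Hx) (subgroup_mulrn HP (2 ^ k) Hy).
  rewrite -mulrnDl !ab /a => h h1 h2 h3 h4 h5 h6.
  have {}h : `|u ((x + y) *+ 2 ^ k) / 2 ^+ k - u (x *+ 2 ^ k) / 2 ^+ k
     - u (y *+ 2 ^ k) / 2 ^+ k| <= B / 2 ^+ k.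
    by rewrite -!mulrBl normrM [X in _ * X]gtr0_norm ?invr_gt0 // ler_pM2r
      ?invr_gt0.
  have -> : 7 * B / 2 ^+ k = 7 * (B / 2 ^+ k) by rewrite mulrA.
  move: h1 h2 h3 h4 h5 h6 h; rewrite -!(mulrA 2) !mulrBl.
  move: (B / 2 ^+ k) (u ((x + y) *+ 2 ^ k) / 2 ^+ k) (u (x *+ 2 ^ k) / 2 ^+ k)
    (u (y *+ 2 ^ k) / 2 ^+ k) => e p p1 p2' ? ? ? ? ? ?.
  by rewrite !ler_norml => /andP[? ?]; apply/andP; split; lra.
apply/eqP; rewrite -subr_eq0 opprD addrA -normr_eq0; set d := `|_| in small *.
apply: contraT => dn0; have d0 : 0 < d by rewrite lt_def dn0 normr_ge0.
have /archi_boundP := divr_ge0 (mulr_ge0 (ler0n _ 7) B0) (ltW d0).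
rewrite ltr_pdivrMr //; set k := Num.bound _ => Bk.
have := small k; rewrite leNgt (lt_le_trans Bk) // mulrC ler_pM2l //.
by rewrite -natrX ler_nat ltnW // ltn_expl.
Qed.
End Homogenization.

Section BallSums.
Variables (Re : realType) (G : zmodType) (q : G -> Re).
Hypothesis qP : group_seminorm q.

(** The [j]-fold sum set of the open unit ball; these sets play the role of bounded sets in the
    subgroup that the ball generates. *)
Fixpoint ball_sum (j : nat) (x : G) : Prop :=
  if j is j'.+1 then exists2 w, q w < 1 & ball_sum j' (x - w) else x = 0.

Lemma ball_sum_cons j x w : q w < 1 -> ball_sum j x -> ball_sum j.+1 (w + x).
Proof. by move=> w1 jx; exists w => //; rewrite addrAC subrr add0r. Qed.

Lemma ball_sum1 x : q x < 1 -> ball_sum 1 x.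
Proof. by move=> x1; rewrite -[x]addr0; exact: ball_sum_cons. Qed.

Lemma ball_sumD j k x y : ball_sum j x -> ball_sum k y -> ball_sum (j + k) (x +
  y).
Proof.
elim: j x => [|j IH] x /=; first by move=> ->; rewrite add0r.
by case=> w w1 xw ky; exists w => //; rewrite addrAC; exact: IH.
Qed.

Lemma ball_sumN j x : ball_sum j x -> ball_sum j (- x).
Proof.
elim: j x => [|j IH] x /=; first by move=> ->; rewrite oppr0.
by case=> w w1 /IH xw; exists (- w); rewrite ?seminormN // -opprD.
Qed.

Lemma ball_sumB j k x y : ball_sum j x -> ball_sum k y -> ball_sum (j + k) (x -
  y).
Proof. by move=> jx /ball_sumN; exact: ball_sumD. Qed.

Lemma ball_sum_mono j k x : (j <= k)%N -> ball_sum j x -> ball_sum k x.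
Proof.
move=> jk jx; rewrite -(subnKC jk) -[x]addr0; apply: ball_sumD => //.
elim: (k - j)%N => //= n IH; exists 0; first by rewrite (seminorm0 qP).
by rewrite subr0.
Qed.

Lemma ball_sum_mulrn j x n : ball_sum j x -> ball_sum (n * j) (x *+ n).
Proof. by move=> jx; elim: n => // n IH; rewrite mulrS mulSn;
  exact: ball_sumD. Qed.

Lemma ball_sum_mulrz j x (k : int) (n : nat) : ball_sum j x -> (`|k| <= n)%N ->
  ball_sum (n * j) (x *~ k).
Proof.
move=> jx kn; apply: (@ball_sum_mono (`|k| * j));
  first by rewrite leq_mul2r kn orbT.
case: k {kn} => k; first exact: ball_sum_mulrn.
by rewrite NegzE mulrNz; apply: ball_sumN; exact: ball_sum_mulrn.
Qed.

Lemma ball_sum_sum j (I : finType) (x : I -> G) (c : I -> nat) :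
  (forall i, ball_sum (c i * j) (x i)) -> ball_sum ((\sum_i c i) * j) (\sum_i x
    i).
Proof.
move=> xc; elim/big_ind2: _ => [|a b m n ab mn|i _]; [by []| |exact: xc].
by rewrite mulnDl; exact: ball_sumD.
Qed.

Definition ball_span := [set x | exists j, ball_sum j x].

Lemma ball_span_subgroup : subgroup ball_span.
Proof.
split; first by exists 0%N.
by move=> x y [j jx] [k ky]; exists (j + k)%N; exact: ball_sumB.
Qed.

Hypothesis unit_ball_tb : totally_bounded [set x | q x < 1] [set x | q x < 1] q.

Lemma ball_sum_tb j : totally_bounded (ball_sum j) (ball_sum j) q.
Proof.
elim: j => [|j IH] e e0.
  exists unit, (fun=> 0); split=> // x ->.
  by exists tt; rewrite subrr seminorm0.
have e20 : 0 < e / 2 by rewrite divr_gt0.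
have [I [t [t1 tP]]] := unit_ball_tb e20; have [K [s [s1 sP]]] := IH _ e20.
exists (I * K)%type, (fun p => t p.1 + s p.2); split=> [p|x [w w1 xw]].
  by apply: ball_sum_cons => //; exact: t1.
have [i ti] := tP _ w1; have [k sk] := sP _ xw; exists (i, k) => /=.
have -> : x - (t i + s k) = (w - t i) + (x - w - s k).
  by rewrite [RHS]addrACA [w + _]addrC subrK opprD.
by rewrite [ltRHS]splitr (le_lt_trans (seminormD qP _ _)) // ltrD.
Qed.
End BallSums.

(** * Recurrence, and a discrete cocompact lattice in [H] *)

Section Lattice.
Variables (Re : realType) (G : zmodType) (q : G -> Re).
Hypothesis qP : group_seminorm q.
Hypothesis unit_ball_tb : totally_bounded [set x | q x < 1] [set x | q x < 1] q.
Local Notation ball_sum := (ball_sum q).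
Local Notation H := (ball_span q).

Section Recurrence.
Variables (L : set G) (f : G).
Hypotheses (LP : subgroup L) (Hf : H f).

(** The times at which the orbit of 0 under translation by [f] in the quotient by [L] visits the
    image of [ball_sum j]. *)
Definition return_times (j : nat) (k : int) := exists2 l,
  L l & ball_sum j (f *~ k - l).
Local Notation S := return_times.

Lemma return_timesB i j k k' : S i k -> S j k' -> S (i + j) (k - k').
Proof.
move=> [l Ll kl] [l' Ll' kl']; exists (l - l'); first exact: subgroupB.
have -> : f *~ (k - k') - (l - l') = (f *~ k - l) - (f *~ k' - l').
  by rewrite mulrzBr !opprD !opprK addrACA.
exact: ball_sumB.
Qed.

(** Finitely many balls of radius 1/2 cover [ball_sum j]. One return time is fixed for each ball
    that is visited; any other for the same ball differs from it by a return time to the unit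
    ball. *)
Lemma return_times_near j : exists K : nat, forall k, S j k ->
  exists k', (`|k'| <= K)%N /\ S 1 (k - k').
Proof.
have h0 : 0 < 2^-1 :> Re by rewrite invr_gt0.
have [I [t [_ tP]]] := ball_sum_tb qP unit_ball_tb j h0.
pose near_t i k := exists2 l, L l & q (f *~ k - l - t i) < 2^-1.
have /choice[kk kkP] : forall i, exists k, (exists k',
  near_t i k') -> near_t i k.
  move=> i; have [[k ik]|nk] := pselect (exists k, near_t i k);
    first by exists k.
  by exists 0 => /nk.
exists (\sum_i `|kk i|)%N => k [l Ll kl].
have [i ti] := tP _ kl; exists (kk i); split;
  first by rewrite (bigD1 i) //= leq_addr.
have [|l' Ll' ti'] := kkP i; first by exists k, l.
exists (l - l'); first exact: subgroupB.
apply: ball_sum1; rewrite [ltRHS]splitr !div1r.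
have -> : f *~ (k - kk i) - (l - l') = (f *~ k - l - t i) - (f *~ kk i - l' - t
  i).
  by rewrite mulrzBr [in RHS]opprB [RHS]addrA subrK !opprD !opprK addrACA.
by apply: le_lt_trans (seminormB qP _ _) _; rewrite ltrD.
Qed.

(** A return time [s] above the bound [K2] allows a step down from any element of [S 2] to another,
    by between 1 and [K]. So [S 2] has gaps at most [K], and the part of [f *~ k] across a gap lies
    in [ball_sum (K * j0)]. *)
Lemma return_times_syndetic j : (forall B : nat, exists2 k,
  S j k & (B < `|k|)%N) ->
  exists m, forall k, S m k.
Proof.
move=> Sj; have [K1 K1P] := return_times_near j.
have {Sj}S1 (B : nat) : exists2 k, S 1 k & (B < `|k|)%N.
  have [k Sk Bk] := Sj (B + K1)%N; have [k' [k'K Skk']] := K1P _ Sk.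
  by exists (k - k') => //; lia.
have [K2 K2P] := return_times_near 2.
have SN i k : S i k -> S i (- k).
  move=> Sk; rewrite -sub0r -(add0n i); apply: return_timesB => //.
  by exists 0; [exact: subgroup0|rewrite mulr0z subr0].
have [s [Ss s0]] : exists s : int, S 1 s /\ (K2%:Z < s)%R.
  have [k Sk kK] := S1 K2; have [k0|k0] := leP 0 k; first by exists k;
    split => //; lia.
  by exists (- k); split; [exact: SN|lia].
pose K := (K2 + `|s|)%N.
have step k : S 2 k -> exists d : nat, [/\ (0 < d)%N,
  (d <= K)%N & S 2 (k - d%:Z)].
  move=> /K2P[k' [k'K /(fun h => return_timesB h Ss)]].
  rewrite -addrA -opprD => h; exists `|(k' + s)%R|%N; split; [lia|lia|].
  by rewrite gez0_abs //; lia.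
have down (n : nat) : exists k, [/\ S 2 k,
  (k <= - n%:Z)%R & (- n%:Z - K%:Z <= k)%R].
  elim: n => [|n [k [Sk k1 k2]]].
    exists 0; split; [|lia|lia].
    by exists 0; [exact: subgroup0|rewrite mulr0z subr0;
      exact: ball_sum_mono (leq0n 2) _].
  have [kn|kn] := ltP k (- n%:Z); first by exists k; split=> //; lia.
  have [d [d0 dK Sd]] := step _ Sk.
  by exists (k - d%:Z); split=> //; lia.
have [j0 fj0] := Hf.
exists (2 + K * j0)%N => k.
have {down step}[k' [Sk' kk']] : exists k', S 2 k' /\ (`|(k - k')%R| <= K)%N.
  have [k0|k0] := leP 0 k.
    have [k' [/SN Sk' h1 h2]] := down `|k|%N; exists (- k'); split=> //; lia.
  by have [k' [Sk' h1 h2]] := down `|k|%N; exists k'; split=> //; lia.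
have [l Ll kl] := Sk'; exists l => //.
have -> : f *~ k - l = (f *~ k' - l) + f *~ (k - k').
  by rewrite mulrzBr [RHS]addrC [RHS]addrA subrK.
by apply: ball_sumD => //; exact: ball_sum_mulrz.
Qed.
End Recurrence.

Section Combinations.
Variables (I : finType) (l : I -> G).
Local Notation V := {ffun I -> int}.

Definition int_combination (v : V) : G := \sum_i l i *~ v i.
Local Notation phi := int_combination.

Lemma int_combinationB v w : phi (v - w) = phi v - phi w.
Proof. by rewrite -sumrB; apply: eq_bigr => i _; rewrite !ffunE mulrzBr. Qed.

Lemma int_combination0 : phi 0 = 0.
Proof. by rewrite -[0 in LHS](subrr 0) int_combinationB subrr. Qed.

Lemma int_combinationD v w : phi (v + w) = phi v + phi w.
Proof. by rewrite -[in LHS](opprK w) int_combinationB -[- w]sub0r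
  int_combinationB int_combination0 sub0r opprK. Qed.

Lemma int_combination_mulrn v n : phi (v *+ n) = phi v *+ n.
Proof. by elim: n => [|n IH]; rewrite ?int_combination0 // !mulrS
  int_combinationD IH. Qed.

Definition supported (J : {set I}) (v : V) := forall i, i \notin J -> v i = 0.

Definition supported_span J := [set x | exists2 v, supported J v & x = phi v].

Lemma supportedB J v w : supported J v -> supported J w -> supported J (v - w).
Proof. by move=> vJ wJ i iJ; rewrite !ffunE vJ // wJ // subrr. Qed.

Lemma supported_span_subgroup J : subgroup (supported_span J).
Proof.
split; first by exists 0; [move=> i _; rewrite ffunE|rewrite int_combination0].
move=> _ _ [v vJ ->] [w wJ ->]; exists (v - w); first exact: supportedB.
by rewrite int_combinationB.
Qed.

Definition cocompact J m :=
  forall x, H x -> exists2 v, supported J v & ball_sum m (x - phi v).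

(** Bounding coefficients rather than points includes independence: if a nonzero supported [v] had
    [phi v = 0], its multiples would violate the bound. *)
Definition discrete J := forall j, exists B : nat, forall v, supported J v ->
  ball_sum j (phi v) -> forall i, (`|v i| <= B)%N.

(* A coordinate that is unbounded on the lattice points of some ball_sum j can
   be dropped, since the multiples of its generator recur modulo the others. *)
Lemma cocompact_drop J m : (forall i,
  H (l i)) -> cocompact J m -> ~ discrete J ->
  exists i m', i \in J /\ cocompact (J :\ i) m'.
Proof.
move=> Hl Jm nJ.
have [j jP] : exists j, forall B : nat, exists v, [/\ supported J v,
  ball_sum j (phi v) &
    exists i, (B < `|v i|)%N].
  apply: contrapT => nj; apply: nJ => j; apply: contrapT => nB; apply: nj.
  exists j => B; apply: contrapT => nv; apply: nB; exists B => v vJ jv i.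
  by rewrite leqNgt; apply/negP => Bi; apply: nv; exists v; split=> //;
    exists i.
have {jP}[i iP] : exists i, forall B : nat, exists v, [/\ supported J v,
    ball_sum j (phi v) & (B < `|v i|)%N].
  apply: contrapT => ni.
  have /choice[b bP] : forall i, exists B : nat, forall v, supported J v ->
      ball_sum j (phi v) -> (`|v i| <= B)%N.
    move=> i; apply: contrapT => nB; apply: ni; exists i => B.
    apply: contrapT => nv; apply: nB; exists B => v vJ jv.
    by rewrite leqNgt; apply/negP => Bi; apply: nv; exists v.
  have [v [vJ jv [k]]] := jP (\sum_i b i)%N; apply/negP; rewrite -leqNgt.
  by apply: leq_trans (bP k v vJ jv) _; rewrite (bigD1 k) //= leq_addr.
have iJ : i \in J.
  by apply: contraT => iJ; have [v [vJ _]] := iP 0%N; rewrite vJ.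
pose drop (v : V) : V := [ffun k => if k == i then 0 else v k].
have dropP v : supported J v -> supported (J :\ i) (drop v).
  by move=> vJ k; rewrite !inE ffunE; case: eqP => //= _; exact: vJ.
have phiE v : phi v = l i *~ v i + phi (drop v).
  rewrite /phi (bigD1 i) //= [in RHS](bigD1 i) //= ffunE eqxx mulr0z add0r.
  by congr (_ + _); apply: eq_bigr => k /negPf ki; rewrite ffunE ki.
have LP := supported_span_subgroup (J :\ i).
have [|m' m'P] := @return_times_syndetic _ _ LP (Hl i) j.
  move=> B; have [v [vJ jv Bv]] := iP B; exists (v i) => //.
  exists (- phi (drop v)); last by rewrite opprK -phiE.
  by apply: subgroupN => //; exists (drop v) => //; exact: dropP.
exists i, (m + m')%N; split=> // x /Jm[v vJ xv].
have [_ [w wJ ->] vw] := m'P (v i).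
exists (drop v + w).
  move=> k kJ; rewrite ffunE [drop v k](dropP v vJ) // [w k]wJ //.
have -> : x - phi (drop v + w) = (x - phi v) + (l i *~ v i - phi w).
  rewrite int_combinationD (phiE v) !opprD addrA [x + (_ + _)]addrA.
  by rewrite [RHS](AC (3*2) (1*2*4*3*5)) /= subrK.
exact: ball_sumD.
Qed.

Lemma discrete_cocompact J m : (forall i, H (l i)) -> cocompact J m ->
  exists J' m', cocompact J' m' /\ discrete J'.
Proof.
move=> Hl; have [n] := ubnP #|J|; elim: n J m => // n IH J m Jn Jm.
have [dJ|ndJ] := pselect (discrete J); first by exists J, m.
have [i [m' [iJ /IH]]] := cocompact_drop Hl Jm ndJ; apply.
by move: Jn; rewrite (cardsD1 i) iJ.
Qed.
End Combinations.

(** Let [W] be the unit ball. The generators form a 1-net of [W + W], which therefore lies in the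
    union of the [l i + W]; by induction each element of [H] is an integer combination plus an
    element of [W]. Dropping generators makes this cocompact family discrete. *)
Lemma exists_lattice : exists (I : finType) (l : I -> G) (J : {set I}) (m :
  nat),
  [/\ forall i, ball_sum 2 (l i), cocompact l J m & discrete l J].
Proof.
have [I [l [l2 lP]]] := ball_sum_tb qP unit_ball_tb 2 ltr01.
suff lm : cocompact l [set: I] 1.
  have [|J [m [Jm dJ]]] := discrete_cocompact _ lm; first by move=> i;
    exists 2%N; exact: l2.
  by exists I, l, J, m.
move=> x [j]; elim: j x => [|j IH] x /=.
  move=> ->; exists 0 => [i|]; first by rewrite inE.
  by rewrite int_combination0 subr0; exact: ball_sum_mono (leq0n 1) _.
move=> [w w1 /IH[v vJ]] /(ball_sumD (ball_sum1 w1)) /lP[i li].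
exists (v + [ffun k => (k == i)%:R]) => [k|]; first by rewrite inE.
apply: ball_sum1; rewrite int_combinationD.
have -> : int_combination l [ffun k => (k == i)%:R] = l i.
  rewrite /int_combination (bigD1 i) //= ffunE eqxx big1 ?addr0 // =>
    k /negPf ki.
  by rewrite ffunE ki mulr0z.
by move: li; rewrite addrCA subrKA opprD addrA.
Qed.
End Lattice.

(** * Additive coordinates and sums of progressions *)

Section LocallyPrecompact.
Variables (Re : realType) (G : zmodType) (q : G -> Re).
Hypothesis qP : group_seminorm q.
Hypothesis unit_ball_tb : totally_bounded [set x | q x < 1] [set x | q x < 1] q.
Local Notation ball_sum := (ball_sum q).
Local Notation H := (ball_span q).

(** The coefficients [v x] of a lattice point near [x] are additive up to a lattice point in
    [ball_sum (m + m + m)], hence up to a constant by discreteness. Their homogenizations [theta i]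
    stay within [B] of them, which gives both bounds. *)
Lemma exists_coordinates : exists (I : finType) (theta : I -> G -> Re) (C : Re)
  (m : nat),
  [/\ forall i x y, H x -> H y -> theta i (x + y) = theta i x + theta i y,
      forall x, q x < 1 -> \sum_i `|theta i x| <= C &
      forall x, H x -> \sum_i `|theta i x| <= 1 -> ball_sum m x].
Proof.
have [I [l [J [m [l2 Jm dJ]]]]] := exists_lattice qP unit_ball_tb.
have HP := ball_span_subgroup qP.
have /choice[v vP] : forall x, exists v, H x ->
    supported J v /\ ball_sum m (x - int_combination l v).
  move=> x; have [/Jm[v vJ xv]|nH] := pselect (H x); first by exists v.
  by exists 0 => /nH.
have [B BP] := dJ (m + m + m)%N.
have vD i x y : H x -> H y -> `|(v (x + y) i)%:~R - (v x i)%:~R - (v y i)%:~R|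
  <= B%:R :> Re.
  move=> Hx Hy; have [vxJ mx] := vP x Hx; have [vyJ my] := vP y Hy.
  have [vxyJ mxy] := vP _ (subgroupD HP Hx Hy).
  have := BP (v (x + y) - v x - v y) _ _ i.
  rewrite !ffunE -!rmorphB -intr_norm -[B%:R]/(B%:Z%:~R) ler_int /= => h.
  rewrite -abszE lez_nat h //; first by do 2!apply: supportedB => //.
  rewrite !int_combinationB.
  have -> : int_combination l (v (x + y)) - int_combination l (v x) -
    int_combination l (v y) =
      (x - int_combination l (v x)) + (y - int_combination l (v y)) -
      (x + y - int_combination l (v (x + y))).
    by rewrite [in RHS]addrACA opprB [RHS]addrC [RHS]addrA subrK addrA.
  by apply: ball_sumB => //; exact: ball_sumD.
have /choice[theta thetaP] : forall i, exists theta : G -> Re,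
    (forall x y, H x -> H y -> theta (x + y) = theta x + theta y) /\
    (forall x, H x -> `|theta x - (v x i)%:~R| <= B%:R).
  move=> i; apply: (quasimorphism_homogenization (u := fun x =>
    (v x i)%:~R)) => //.
  exact: vD.
have thetav i x : H x -> `|theta i x - (v x i)%:~R| <= B%:R by case: (thetaP i)
  => _; apply.
have [B1 B1P] := dJ (1 + m)%N.
exists I, theta, (#|I|%:R * (B%:R + B1%:R)),
  (m + (\sum_(i : I) (B + 1)) * 2)%N; split.
- by move=> i; case: (thetaP i).
- move=> x x1; rewrite mulr_natl -sumr_const; apply: ler_sum => i _.
  have Hx : H x by exists 1%N; exact: ball_sum1.
  have [vJ xm] := vP _ Hx.
  have := B1P _ vJ _ i; rewrite -[int_combination l _](subKr x) =>
    /(_ (ball_sumB qP (ball_sum1 x1) xm)).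
  rewrite -(ler_nat Re) -[X in X <= _]/(`|v x i|%:Z%:~R) abszE intr_norm => h.
  have := thetav i x Hx; have := ler_normD (theta i x - (v x i)%:~R) (v x
    i)%:~R.
  by rewrite subrK; lra.
- move=> x Hx x1; have [vJ xm] := vP _ Hx.
  rewrite -(subrK (int_combination l (v x)) x); apply: ball_sumD => //.
  apply: ball_sum_sum => i; apply: ball_sum_mulrz => //.
  rewrite -lez_nat -(ler_int Re) abszE intr_norm PoszD rmorphD /=.
  have : `|theta i x| <= 1.
    apply: le_trans x1; rewrite (bigD1 i) //= lerDl; exact: sumr_ge0.
  have := thetav i x Hx; have := ler_normB (theta i x) (theta i x - (v x
    i)%:~R).
  by rewrite subKr; rewrite -[B%:~R]/(B%:R : Re); lra.
Qed.

(* After passing to the quotient by a sublattice whose nonzero points avoid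
   ball_sum 3, the group becomes totally bounded; partial sums never leave the
   unit ball, hence do not see the sublattice. *)
Lemma small_progressions_sum : exists2 d : Re, 0 < d &
  forall (K : finType) (y : K -> G) (n : K -> nat),
    (forall j k, (k <= n j)%N -> q (y j *+ k) <= d) -> (forall j,
      (0 < n j)%N) ->
    \sum_j (n j)%:R^-1 <= 2^-1 :> Re -> q (\sum_j y j) < 1.
Proof.
have [I [l [J [m [l2 Jm dJ]]]]] := exists_lattice qP unit_ball_tb.
have HP := ball_span_subgroup qP.
(* Lattice points in [ball_sum 3] have coefficients at most [B], and a nonzero multiple of [c]
   exceeds this. *)
have [B BP] := dJ 3%N; pose c := B.+1.
pose L := [set x | exists2 v, supported J v & x = int_combination l v *+ c].
have LD x y : L x -> L y -> L (x + y).
  move=> [v vJ ->] [w wJ ->]; exists (v + w);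
    last by rewrite int_combinationD mulrnDl.
  by move=> i iJ; rewrite ffunE vJ // wJ.
have L0 : L 0 by exists 0 => [i _|]; rewrite ?ffunE // int_combination0 mul0rn.
have L3 x : L x -> ball_sum 3 x -> x = 0.
  move=> [v vJ ->]; rewrite -int_combination_mulrn => v3.
  suff -> : v = 0 by rewrite mul0rn int_combination0.
  apply/ffunP => i; rewrite ffunE; apply/eqP; rewrite -absz_eq0.
  have vcJ : supported J (v *+ c) by move=> k kJ; rewrite ffunMnE vJ // mul0rn.
  have := BP _ vcJ v3 i; rewrite ffunMnE /c -mulr_natr abszM.
  by case: `|v i|%N => // n; rewrite natz absz_nat /=; lia.
(* Giving the elements of [L] weight 0 turns the gauge into the quotient seminorm modulo [L]. *)
pose P (g : G) (w : Re) := w = q g \/ w = 0 /\ L g.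
have P_ge0 g w : P g w -> 0 <= w by case=> [->|[-> //]]; exact: seminorm_ge0.
have PN g w : P g w -> P (- g) w.
  case=> [->|[-> [v vJ ->]]]; [by left; rewrite seminormN|right; split=> //].
  exists (- v) => [i iJ|]; first by rewrite ffunE vJ // oppr0.
  by rewrite -[- v]sub0r int_combinationB int_combination0 sub0r mulNrn.
have P_total g : exists w, P g w by exists (q g); left.
have gP := gauge_seminorm P_ge0 PN P_total.
have gle x : gauge P x <= q x.
  by apply: (gauge_le P_ge0 (n := 1)); apply: cost_generator; left.
have gL x : L x -> gauge P x <= 0.
  by move=> Lx; apply: (gauge_le P_ge0 (n := 1)); apply: cost_generator; right.
have costL n x d : cost P n x d -> exists2 g, L g & q (x - g) <= d.
  elim=> [|{}n g w {}x {}d Pg _ [g' Lg' xd]]; first by exists 0;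
    rewrite // subr0 seminorm0.
  case: Pg => [->|[-> Lg]].
    exists g' => //; rewrite -addrA; apply: le_trans (seminormD qP _ _) _.
    by rewrite lerD2l.
  exists (g + g'); first exact: LD.
  by rewrite opprD addrACA subrr !add0r.
(* Dividing lattice coefficients by [c] with remainder moves any [x] modulo [L] into one fixed
   [ball_sum]. The factor 6 turns the bound 5 of [sum_progressions] into a gauge below 1. *)
have gtb : totally_bounded H H (fun x => 6 * gauge P x).
  move=> e e0; have e6 : 0 < e / 6 by rewrite divr_gt0.
  pose M := (m + (\sum_(i : I) c) * 2)%N.
  have [T [t [tM tP]]] := ball_sum_tb qP unit_ball_tb M e6.
  exists T, t; split=> [i|x /Jm[v vJ xv]]; first by exists M; exact: tM.
  pose v1 : {ffun I -> int} := [ffun i => (v i %/ c)%Z].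
  pose v2 : {ffun I -> int} := [ffun i => (v i %% c)%Z].
  have vE : v = v1 *+ c + v2.
    apply/ffunP => i; rewrite ffunE ffunMnE !ffunE [LHS](divz_eq _ c).
    by rewrite -[_ *+ c]mulr_natr natz.
  have Lv1 : L (int_combination l v1 *+ c).
    by exists v1 => // i iJ; rewrite ffunE vJ // div0z.
  have : ball_sum M (x - int_combination l v1 *+ c).
    have -> : x - int_combination l v1 *+ c = x - int_combination l v +
      int_combination l v2.
      by rewrite [in RHS]vE int_combinationD int_combination_mulrn opprD addrA
        subrK.
    apply: ball_sumD => //; apply: ball_sum_sum => i;
      apply: ball_sum_mulrz => //.
    by rewrite ffunE; lia.
  move=> /tP[i ti]; exists i; rewrite -ltr_pdivlMl // mulrC.
  apply: le_lt_trans ti; rewrite -(subrK (int_combination l v1 *+ c) x).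
  rewrite -addrA addrC -addrA.
  apply: le_trans (seminormD gP _ _) _.
  by rewrite addrC addrK -[leRHS]add0r lerD // ?gL // addrC.
have [d d0 dP] := sum_progressions (seminorm_scale gP (ler0n _ 6)) HP gtb.
exists (Num.min (d / 6) 2^-1); first by rewrite lt_min divr_gt0 //= invr_gt0.
move=> K y n ym n0 sn.
have y1 j : q (y j) < 1.
  have := ym j 1%N (n0 j); rewrite mulr1n le_min => /andP[_]; lra.
have sum1 (S : {set K}) : gauge P (\sum_(j in S) y j) < 1.
  have := dP K (fun j => if j \in S then y j else 0) n.
  rewrite -big_mkcond /= => h; suff : 6 * gauge P (\sum_(j in S) y j) < 5 by
    lra.
  apply: h => // [j|j k kn].
    by case: ifP => _; [exists 1%N; exact: ball_sum1|exact: subgroup0].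
  case: ifP => _; last by rewrite mul0rn seminorm0 // mulr0 ltW.
  have := ym j k kn; rewrite le_min => /andP[+ _].
  by have := gle (y j *+ k); rewrite ler_pdivlMr //; lra.
suff H1 (S : {set K}) : q (\sum_(j in S) y j) < 1.
  by have := H1 [set: K]%SET; rewrite big_mkcond /=;
    under eq_bigr do rewrite inE.
(* Adding one [y j] keeps the sum in [ball_sum 2]. An element [g] of [L] within distance 1 of the
   sum then lies in [ball_sum 3], hence is 0. *)
have [N] := ubnP #|S|; elim: N S => // N IH S SN.
have [->|[j jS]] := set_0Vmem S; first by rewrite big_set0 seminorm0.
have IHj : q (\sum_(k in S :\ j) y k) < 1.
  by apply: IH; move: SN; rewrite (cardsD1 j) jS.
have S2 : ball_sum 2 (\sum_(k in S) y k).
  by rewrite (big_setD1 j) //=; apply: (@ball_sumD _ _ q 1 1); exact: ball_sum1.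
have /(gauge_lt P_total)[n1 [e [/costL[g Lg Sg] e1]]] := sum1 S.
have Sg1 := le_lt_trans Sg e1.
suff g0 : g = 0 by rewrite g0 subr0 in Sg1.
apply: L3 => //; rewrite -[g](subKr (\sum_(k in S) y k)).
by apply: (ball_sumB qP (j := 2) (k := 1)) => //; exact: ball_sum1.
Qed.
End LocallyPrecompact.

(** * Topological groups and locally compact rings *)

Section Rng.
Variable R : topologicalRngType.
Implicit Types a x : R.

Lemma rngM0 a : rngM a 0 = 0.
Proof. by apply: (addrI (rngM a 0)); rewrite -rngMDr !addr0. Qed.

Lemma rng0M a : rngM 0 a = 0.
Proof. by apply: (addrI (rngM 0 a)); rewrite -rngMDl !addr0. Qed.

Lemma rngMN a x : rngM a (- x) = - rngM a x.
Proof. by apply: (addrI (rngM a x)); rewrite -rngMDr !subrr rngM0. Qed.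

Lemma rngM_mulrn a x n : rngM a (x *+ n) = rngM a x *+ n.
Proof. by elim: n => [|n IH]; rewrite ?rngM0 // !mulrS rngMDr IH. Qed.
End Rng.

Section TopologicalGroup.
Variables (Re : realType) (G : topologicalZmodType).

Lemma nbhs0_sub (A : set G) : nbhs 0 A ->
  exists2 B, nbhs 0 B & forall x y, B x -> B y -> A (x - y).
Proof.
move=> A0; have : nbhs ((0, 0) : G * G) [set z | A (z.1 - z.2)].
  by apply: (@sub_continuous G (0, 0)); rewrite /= subr0.
case=> -[B1 B2] /= [B10 B20] BA; exists (B1 `&` B2); first exact: filterI.
by move=> x y [Bx _] [_ By]; exact: (BA (x, y)).
Qed.

Lemma nbhs0_translate (A : set G) x : nbhs 0 A -> nbhs x [set y | A (y - x)].
Proof.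
move=> A0; apply: (@continuous_comp _ _ _ (fun y => (y,
  x)) (fun z : G * G => z.1 - z.2)).
- by apply: cvg_pair => /=; [exact: cvg_id|exact: cvg_cst].
- exact: sub_continuous.
- by rewrite /= subrr.
Qed.

Lemma seminorm_continuous (q : G -> Re) : group_seminorm q ->
  (forall e, 0 < e -> nbhs 0 [set x | q x < e]) -> continuous q.
Proof.
move=> qP q0 x; apply/cvgrPdist_lt => e e0.
apply: filterS (nbhs0_translate x (q0 e e0)) => y /= qe.
by apply: le_lt_trans qe; rewrite distrC; exact: seminorm_dist.
Qed.

Lemma is_seminormP (q : G -> Re) : group_seminorm q -> continuous q ->
  is_seminorm q.
Proof.
move=> qP qc; split=> //.
- exact: seminorm_ge0.
- exact: seminorm0.
- exact: seminormN.
- exact: seminormD.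
Qed.

Lemma seminorm_nbhs (q : G -> Re) e : q 0 = 0 -> continuous q -> 0 < e ->
  nbhs 0 [set x | q x < e].
Proof.
move=> q00 qc e0; have := qc 0;
  rewrite /continuous_at q00 => /cvgrPdist_lt/(_ e e0).
by apply: filterS => x /=; rewrite sub0r normrN; apply: le_lt_trans;
  exact: ler_norm.
Qed.

(** The seminorm is the gauge in which elements of [W n.+1] weigh [2^-1 ^+ n], for neighborhoods
    such that three elements of [W n.+1] add up to one of [W n]. *)
Lemma birkhoff_kakutani (U : set G) : nbhs 0 U ->
  exists q : G -> Re, [/\ group_seminorm q,
    continuous q & [set x | q x < 1] `<=` U].
Proof.
move=> U0; have /choice[step stepP] : forall A : set G, exists B, nbhs 0 A ->
    [/\ nbhs 0 B, forall x, B x -> B (- x) &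
        forall x y z, B x -> B y -> B z -> A (x + y + z)].
  move=> A; have [A0|nA] := pselect (nbhs 0 A); last by exists set0.
  have [B B0 BA] := nbhs0_sub A0; have [C C0 CB] := nbhs0_sub B0.
  have [D D0 DC] := nbhs0_sub C0.
  have C00 := nbhs_singleton C0; have D00 := nbhs_singleton D0.
  have DN x : D x -> C (- x) by move=> Dx; rewrite -sub0r; exact: DC.
  have DD x : D x -> C x by move=> Dx; rewrite -[x]subr0; exact: DC.
  have CC x : C x -> B x by move=> Cx; rewrite -[x]subr0; exact: CB.
  have CN x : C x -> B (- x) by move=> Cx; rewrite -sub0r; exact: CB.
  exists (D `&` [set x | D (- x)]) => _; split.
  - apply: filterI => //.
    by apply: (@opp_continuous G 0); rewrite oppr0.
  - by move=> x [Dx DNx]; split=> //=; rewrite opprK.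
  - move=> x y z [Dx Nx] [Dy Ny] [Dz Nz]; rewrite -[z]opprK; apply: BA.
      by rewrite -[y]opprK; apply: CB; [exact: DD|exact: DN].
    by apply: CC; exact: DN.
pose W n := iter n step U.
have W0 n : nbhs 0 (W n) by elim: n => // n /stepP[].
have WN n x : W n.+1 x -> W n.+1 (- x) by have [_ + _] := stepP _ (W0 n); apply.
have W3 n x y z : W n.+1 x -> W n.+1 y -> W n.+1 z -> W n (x + y + z).
  by have [_ _] := stepP _ (W0 n); apply.
have W00 n : W n 0 by exact: (nbhs_singleton (W0 n)).
have Wmono n k x : W (n + k)%N x -> W n x.
  elim: k => [|k IH]; first by rewrite addn0.
  rewrite addnS => Wx; apply: IH.
  by have := W3 _ _ _ _ Wx (W00 _) (W00 _); rewrite !addr0.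
(* Weight 2 makes every element a generator and is too large to occur in a chain of weight below
   1. *)
pose P (g : G) (w : Re) := (exists2 n, w = 2^-1 ^+ n & W n.+1 g) \/ w = 2.
have P_gt0 g w : P g w -> 0 < w.
  by case=> [[n -> _]|->]; rewrite ?exprn_gt0 ?invr_gt0.
have P_ge0 g w : P g w -> 0 <= w by move=> /P_gt0/ltW.
have PN g w : P g w -> P (- g) w.
  by case=> [[n wn Wg]|->]; [left; exists n => //; exact: WN|right].
have P_total g : exists w, P g w by exists 2; right.
have gP := gauge_seminorm P_ge0 PN P_total.
(* Splitting at half the weight leaves two sums in [W k.+1] by induction; the generator between them
   weighs less than [2^-1 ^+ k], so it is in [W k.+1] too. *)
have costW N k x c : cost P N x c -> c < 2^-1 ^+ k -> W k x.
  elim/ltn_ind: N k x c => N IH k x c xc ck.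
  have [c0|c0] := leP c 0.
    case: xc c0 {ck} => [_|n g w y d Pg /(cost_ge0 P_ge0) d0]; first exact: W00.
    by have := P_gt0 _ _ Pg; lra.
  have [||n1 [n2 [x1 [x2 [g [c1 [c2 [w [[xc1 xc2 Pg ->] [n1N n2N c1c c2c
    wc]]]]]]]]]] :=
    cost_split P_ge0 xc (h := c / 2); [lra|lra|].
  have ck2 : c / 2 < 2^-1 ^+ k.+1 by rewrite exprS; lra.
  apply: W3; [exact: IH xc1 (le_lt_trans c1c ck2)| |apply: IH xc2 _ => //; lra].
  case: Pg => [[n wn Wg]|w2]; last first.
    by have := exprn_ile1 k (_ : 0 <= 2^-1 :> Re) (_ : 2^-1 <= 1 :> Re); lra.
  have kn : (k < n)%N.
    rewrite ltnNge; apply/negP => nk; move: (le_lt_trans wc ck); rewrite wn.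
    by rewrite ltNge ler_wiXn2l //; lra.
  by apply: (Wmono k.+1 (n - k)%N); rewrite addSn subnKC // ltnW.
exists (gauge P); split=> //.
  apply: seminorm_continuous => // e e0.
  have [n ne] : exists n, 2^-1 ^+ n < e.
    have /archi_boundP : 0 <= e^-1 by rewrite invr_ge0 ltW.
    set n := Num.bound _ => ne; exists n.
    rewrite exprVn invf_plt ?posrE ?exprn_gt0 // (lt_trans ne) //.
    by rewrite -natrX ltr_nat ltn_expl.
  apply: filterS (W0 n.+1) => x Wx /=; apply: le_lt_trans ne.
  by apply: (gauge_le P_ge0 (n := 1)); apply: cost_generator; left; exists n.
move=> x /= /(gauge_lt P_total)[n [d [xd d1]]].
by apply: (costW n 0%N x d xd); rewrite expr0.
Qed.

Lemma compact_totally_bounded (A : set G) (q : G -> Re) : compact A ->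
  group_seminorm q -> continuous q -> totally_bounded A setT q.
Proof.
move=> /compact_near_coveringP cA qP qc e e0.
(* Lists directed by inclusion: a given point is eventually a member, so near covering yields one
   finite list of centres for all of [A]. *)
pose F := filter_from [set: seq G] (fun s0 =>
  [set s : seq G | {subset s0 <= s}]).
have FF : Filter F.
  apply: filter_from_filter => [|s1 s2 _ _]; first by exists [::].
  exists (s1 ++ s2) => // s /= sub.
  by split=> x xs; apply: sub; rewrite mem_cat xs ?orbT.
have [x _|s0 _ /(_ s0)] := cA _ F (fun (s : seq G) x => exists2 t,
  t \in s & q (x - t) < e) FF.
  exists ([set y | q (y - x) < e], [set s : seq G | x \in s]) => /=.
    split; first exact: nbhs0_translate (seminorm_nbhs (seminorm0 qP) qc e0).
    by exists [:: x] => // s; apply; rewrite mem_head.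
  by move=> [y s] /= [yx xs]; exists x.
move=> /(_ (fun x xs => xs)) As0.
exists 'I_(size s0), (fun i : 'I_(size s0) => s0`_i);
  split=> // x /As0[t ts0 xt].
move: (ts0); rewrite -index_mem => its0.
by exists (Ordinal its0); rewrite /= nth_index.
Qed.
End TopologicalGroup.

(** Each centre of an [e / 2]-net is moved to a point of [B] within [e / 2] if there is one, and to
    [b0] otherwise. *)
Lemma totally_bounded_inside (Re : realType) (G : zmodType) (A B : set G) (q :
  G -> Re) :
  group_seminorm q -> B !=set0 -> B `<=` A -> totally_bounded A setT q ->
  totally_bounded B B q.
Proof.
move=> qP [b0 Bb0] BA Aq e e0; have e20 : 0 < e / 2 by rewrite divr_gt0.
have [I [t [_ tP]]] := Aq _ e20.
have /choice[s sP] : forall i, exists s, B s /\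
    ((exists2 x, B x & q (x - t i) < e / 2) -> q (s - t i) < e / 2).
  move=> i; have [[x Bx xi]|ni] := pselect (exists2 x,
    B x & q (x - t i) < e / 2).
    by exists x.
  by exists b0; split=> // /ni.
exists I, s; split=> [i|x Bx]; first by have [] := sP i.
have [i xi] := tP _ (BA _ Bx); exists i.
have {sP}[_ /(_ (ex_intro2 _ _ x Bx xi)) si] := sP i.
rewrite -(subrKA (t i)) [ltRHS]splitr (le_lt_trans (seminormD qP _ _)) //.
by rewrite ltrD // seminormBC.
Qed.

Section Reals.
Variable Re : realType.

(** The integer part of [w^-1], or a large [n] when [w = 0], where [e] provides the room. It serves
    as the length of a progression attached to the seminorm value [w]. *)
Lemma exists_invn_approx (w e : Re) : 0 <= w <= 1 -> 0 < e ->
  exists n : nat, [/\ (0 < n)%N, n%:R * w <= 1 & n%:R^-1 <= 2 * w + e].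
Proof.
move=> /andP[w0 w1] e0; have [->|wn0] := eqVneq w 0.
  have /archi_boundP : 0 <= e^-1 by rewrite invr_ge0 ltW.
  set n := Num.bound _ => en; exists n.
  have n0 : 0 < n%:R :> Re by apply: lt_trans en; rewrite invr_gt0.
  split; first by rewrite -(ltr0n Re).
    by rewrite mulr0 ler01.
  by rewrite mulr0 add0r -[e]invrK lef_pV2 ?posrE ?invr_gt0 // ltW.
have {wn0}w0 : 0 < w by rewrite lt_def wn0.
have w1' : 1 <= w^-1 by rewrite -[leLHS]invr1 lef_pV2 ?posrE.
have n0 : (0 < Num.truncn w^-1)%N by rewrite truncn_gt0.
have /truncn_itv : 0 <= w^-1 by rewrite invr_ge0 ltW.
set n := Num.truncn _ in n0 * => /andP[nw wn]; exists n.
split=> //; first by rewrite -ler_pdivlMr // div1r.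
have n1 : 1 <= n%:R :> Re by rewrite ler1n.
have n2 : w^-1 < 2 * n%:R by apply: lt_le_trans wn _; rewrite -natr1; lra.
suff : n%:R^-1 <= 2 * w by lra.
by rewrite -[leLHS]mul1r ler_pdivrMr ?ltr0n // mulrAC -ler_pdivrMr // div1r ltW.
Qed.

(** Choosing [n] close to [al^-1] turns a uniform bound on multiples into a linear estimate. *)
Lemma le_of_multiples (al be C : Re) : 0 <= al <= 1 -> 0 <= C ->
  (forall n : nat, (0 < n)%N -> n%:R * al <= 1 -> n%:R * be <= C) ->
  be <= C * (2 * al).
Proof.
move=> al01 C0 H; apply/ler_addgt0Pr => e e0.
have eC : 0 < e / (C + 1) by rewrite divr_gt0 // ltr_wpDl.
have [n [n0 na nC]] := exists_invn_approx al01 eC.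
have := H n n0 na; rewrite mulrC -ler_pdivlMr ?ltr0n // => h.
apply: le_trans h _; apply: le_trans (ler_wpM2l C0 nC) _.
rewrite mulrDr lerD2l mulrCA ler_piMr ?(ltW e0) //.
by rewrite ler_pdivrMr ?mul1r ?lerDl // ltr_wpDl.
Qed.

(** The terms of either sign form a subset whose sum has no cancellation. *)
Lemma sum_norm_le_subsets (J : finType) (t : J -> Re) (M : Re) :
  (forall E : {set J}, `|\sum_(j in E) t j| <= M) -> \sum_j `|t j| <= 2 * M.
Proof.
move=> tM; have := tM [set j | 0 <= t j]%SET; have := tM [set j | t j < 0]%SET.
set S1 := \sum_(j in _) _; set S2 := \sum_(j in _) _ => h1 h2.
have -> : \sum_j `|t j| = S2 - S1.
  rewrite (bigID (fun j => 0 <= t j)) /= /S1 /S2 -sumrN; congr (_ + _).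
    by apply: eq_big => j; [rewrite inE|exact: ger0_norm].
  by apply: eq_big => j; [rewrite inE ltNge|rewrite -ltNge; exact: ltr0_norm].
by have := ler_norm S2; have := ler_norm (- S1); rewrite normrN; lra.
Qed.

Lemma max_partial_norm_ge (G : zmodType) (p : G -> Re) (J : finType) (x : J ->
  G)
  (E : {set J}) : p (\sum_(i in E) x i) <= max_partial_norm p x.
Proof. exact: (le_bigmax _ (fun E : {set J} => p (\sum_(i in E) x i))). Qed.

Lemma max_partial_norm_ge0 (G : zmodType) (p : G -> Re) (J : finType) (x : J ->
  G) :
  0 <= max_partial_norm p x.
Proof. exact: bigmax_ge_id. Qed.

Lemma max_partial_norm_le (G : zmodType) (p : G -> Re) (J : finType) (x : J ->
  G) (M : Re) :
  0 <= M -> (forall E : {set J}, p (\sum_(i in E) x i) <= M) ->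
    max_partial_norm p x <= M.
Proof. by move=> M0 pM; apply/bigmax_leP; split. Qed.
End Reals.

(** * Seminorms on locally compact rings *)

Section LocallyCompact.
Variables (Re : realType) (R : topologicalRngType).

Lemma rngM_small (A U : set R) : compact A -> nbhs 0 U ->
  exists2 V : set R, nbhs 0 V & forall a x, V a -> A x -> U (rngM a x).
Proof.
move=> /compact_near_coveringP cA U0.
exists [set a | A `<=` (fun x => U (rngM a x))]; last by move=> a x + Ax; apply.
apply: cA => x _; have : nbhs ((0, x) : R * R) [set z | U (rngM z.1 z.2)].
  by apply: (@rngM_continuous R (0, x)); rewrite /= rng0M.
case=> -[V W] /= [V0 Wx] VWU; exists (W, V) => //= -[x' a] /= [Wx' Va].
exact: (VWU (a, x')).
Qed.

(* The coordinates [theta] only control finitely many directions; the seminorm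
   [r] they define is corrected into one adapted to [U] by adding the largest
   seminorm below [q] that is at most [8 * r x] at every product [a x] with
   [a] in [V]. *)
Lemma locally_compact_seminormable :
  locally_compact_space R -> unconditionally_seminormable Re R.
Proof.
move=> lcR U U0.
have [A A0 cA] := lcR 0.
have [U1 U10 U1U] := nbhs0_sub (filterI U0 A0).
have U11 := nbhs_singleton U10.
have [q [qP qc qU1]] := birkhoff_kakutani Re U10.
have qA x : q x < 1 -> A x.
  by move=> /qU1 Ux; have [_] := U1U _ _ Ux U11; rewrite subr0.
have tbW : totally_bounded [set x | q x < 1] [set x | q x < 1] q.
  apply: (totally_bounded_inside qP (A := A)) => //.
    by exists 0; rewrite /= seminorm0.
  exact: compact_totally_bounded.
have HP := ball_span_subgroup qP.
have [I [theta [C [m [thD thC thm]]]]] := exists_coordinates qP tbW.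
have [d d0 dP] := small_progressions_sum qP tbW.
set H := ball_span q in HP thD thm.
have H1 x : q x < 1 -> H x by move=> x1; exists 1%N; exact: ball_sum1.
have th0 i : theta i 0 = 0.
  by apply: (addrI (theta i 0)); rewrite -thD ?addr0 //; exact: subgroup0.
have thN i x : H x -> theta i (- x) = - theta i x.
  move=> Hx; apply: (addrI (theta i x)).
  by rewrite -thD ?subrr ?th0 //; exact: subgroupN.
have thn i x n : H x -> theta i (x *+ n) = n%:R * theta i x.
  move=> Hx; elim: n => [|n IH]; first by rewrite th0 mul0r.
  by rewrite mulrS thD ?IH -?natr1 ?mulrDl ?mul1r 1?addrC //;
    exact: subgroup_mulrn.
have thsum i (J : finType) (E : {set J}) (x : J -> R) : (forall j, H (x j)) ->
    theta i (\sum_(j in E) x j) = \sum_(j in E) theta i (x j).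
  move=> Hx; suff [] : H (\sum_(j in E) x j) /\
    theta i (\sum_(j in E) x j) = \sum_(j in E) theta i (x j) by [].
  elim/big_ind2: _ => [|a y b z [Hy <-] [Hz <-]|//].
    by split; [exact: subgroup0|exact: th0].
  by split; [exact: subgroupD|exact: thD].
pose s x := \sum_i `|theta i x|.
have s_ge0 x : 0 <= s x by exact: sumr_ge0.
have sn x n : H x -> s (x *+ n) = n%:R * s x.
  move=> Hx; rewrite /s mulr_sumr; apply: eq_bigr => i _.
  by rewrite thn // normrM normr_nat.
have C0 : 0 <= C by apply: le_trans (thC 0 _); rewrite ?(seminorm0 qP) //;
  exact: sumr_ge0.
(* Truncation at 1 extends [s] from [H] to all of [R]; where [r] is below 1 the two agree. *)
pose r x := if `[< H x >] then Num.min (s x) 1 else 1.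
have rH x : r x < 1 -> H x /\ r x = s x.
  rewrite /r; case: asboolP => Hx; last by rewrite ltxx.
  by rewrite gt_min ltxx orbF => s1; split=> //; rewrite min_l // ltW.
have r_ge0 x : 0 <= r x by rewrite /r; case: asboolP => // _;
  rewrite le_min s_ge0 /=.
have r_le1 x : r x <= 1 by rewrite /r; case: asboolP => // _;
  rewrite ge_min lexx orbT.
have r_les x : H x -> r x <= s x.
  by move=> Hx; rewrite /r; case: asboolP => // _; rewrite ge_min lexx.
have rP : group_seminorm r.
  split=> [|x|x y].
  - apply/eqP; rewrite eq_le r_ge0 andbT (le_trans (r_les _ (subgroup0 HP))) //.
    by rewrite /s big1 // => i _; rewrite th0 normr0.
  - have HN : H (- x) <-> H x.
      by split=> [/(subgroupN HP)|]; [rewrite opprK|exact: subgroupN].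
    rewrite /r (asbool_equiv_eq HN); case: asboolP => // Hx;
      congr (Num.min _ _).
    by apply: eq_bigr => i _; rewrite thN // normrN.
  - have [x1|x1] := ltP (r x) 1; last by rewrite (le_trans (r_le1 _)) //
    ler_wpDr.
    have [y1|y1] := ltP (r y) 1; last by rewrite (le_trans (r_le1 _)) //
      ler_wpDl.
    have [Hx ->] := rH _ x1; have [Hy ->] := rH _ y1.
    apply: le_trans (r_les _ (subgroupD HP Hx Hy)) _.
    by rewrite -big_split; apply: ler_sum => i _ /=; rewrite thD // ler_normD.
have rc : continuous r.
  apply: seminorm_continuous => // e e0.
  have [n] : exists n : nat, C / e < n%:R.
    by exists (Num.bound (C / e)); apply: archi_boundP; rewrite divr_ge0 // ltW.
  rewrite ltr_pdivrMr // => Cn.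
  have n0 : 0 < n%:R :> Re.
    by rewrite -(pmulr_lgt0 _ e0) (le_lt_trans C0).
  have : 0 < n%:R^-1 :> Re by rewrite invr_gt0.
  move=> /(seminorm_nbhs (seminorm0 qP) qc); apply: filterS => x /= xn.
  have nx1 : q (x *+ n) < 1.
    by apply: le_lt_trans (seminorm_mulrn qP _ _) _;
      rewrite mulrC -ltr_pdivlMr // div1r.
  have Hx : H x.
    apply: H1; apply: lt_le_trans xn _;
      rewrite invf_le1 // ler1n -(ltr0n Re) //.
  apply: le_lt_trans (r_les _ Hx) _; rewrite -(ltr_pM2l n0) -sn //.
  exact: le_lt_trans (thC _ nx1) Cn.
pose d' := Num.min d 2^-1.
have d'0 : 0 < d' by rewrite lt_min d0 invr_gt0 /=.
have d'd : d' <= d by rewrite ge_min lexx.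
have d'1 : d' < 1 by rewrite gt_min; apply/orP; right; lra.
(* An element of [H] with [s x <= 1] is a sum of [m] elements of the unit ball, so this bound on
   each product gives at most [d'] in total; [m.+1] avoids division by 0. *)
have dm : 0 < d' / m.+1%:R by rewrite divr_gt0 // ltr0Sn.
have [V V0 VA] := rngM_small cA (seminorm_nbhs (seminorm0 qP) qc dm).
have Vball k a x : V a -> ball_sum q k x -> q (rngM a x) <= k%:R * (d' /
  m.+1%:R).
  move=> Va; elim: k x => [|k IH] x /=; first by move=> ->;
    rewrite rngM0 seminorm0 // mul0r.
  move=> [w w1 /IH xw]; rewrite -(subrK w x) rngMDr -natr1 mulrDl mul1r.
  apply: le_trans (seminormD qP _ _) _; apply: lerD => //.
  by apply/ltW/VA => //; exact: qA.
have Vs a x : V a -> H x -> s x <= 1 -> q (rngM a x) <= d'.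
  move=> Va Hx /(thm _ Hx) /(Vball _ _ _ Va) h; apply: le_trans h _.
  by rewrite mulrA ler_pdivrMr ?ltr0Sn // mulrC ler_pM2l // ler_nat.
have Vn a x n : V a -> H x -> n%:R * s x <= 1 -> q (rngM a x *+ n) <= d'.
  by move=> Va Hx nx; rewrite -rngM_mulrn; apply: Vs => //;
    [exact: subgroup_mulrn|rewrite sn].
have rV a x : V a -> r (rngM a x) <= (2 * C + 1) * r x.
  move=> Va; have [x1|x1] := ltP (r x) 1; last first.
    have -> : r x = 1 by apply/eqP; rewrite eq_le r_le1.
    by rewrite mulr1 (le_trans (r_le1 _)) // lerDr mulr_ge0.
  have [Hx rE] := rH _ x1; rewrite rE in x1 *.
  have Hax : H (rngM a x).
    by apply: H1; apply: le_lt_trans d'1; apply: Vs => //; exact: ltW.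
  apply: le_trans (r_les _ Hax) _.
  have := @le_of_multiples Re (s x) (s (rngM a x)) C.
  rewrite s_ge0 ltW //= => /(_ isT C0) h.
  apply: (@le_trans _ _ (C * (2 * s x))); last first.
    by rewrite [leRHS]mulrDl mul1r mulrCA mulrA lerDl.
  apply: h => n n0 nx; rewrite -sn //; apply: thC; apply: le_lt_trans d'1.
  exact: Vn.
(* Lengths [n j] near [(r (x j))^-1] keep the multiples of the products small, and the inverse
   lengths sum to at most [2 / 8 + 1 / 4], the 1/2 that [dP] allows. *)
have sumV (J : finType) (a x : J -> R) : (forall j, V (a j)) ->
    \sum_j r (x j) <= 8^-1 -> q (\sum_j rngM (a j) (x j)) < 1.
  move=> Va x8.
  have rx j : r (x j) < 1.
    apply: (@le_lt_trans _ _ 8^-1); last lra.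
    by apply: le_trans x8; rewrite (bigD1 j) //= lerDl; exact: sumr_ge0.
  pose e : Re := 4^-1 / (#|J|%:R + 1).
  have e0 : 0 < e by rewrite divr_gt0 ?invr_gt0 // ltr_wpDl.
  have /choice[n nP] : forall j, exists n : nat,
      [/\ (0 < n)%N, n%:R * r (x j) <= 1 & n%:R^-1 <= 2 * r (x j) + e].
    by move=> j; apply: exists_invn_approx => //; rewrite r_ge0 r_le1.
  apply: (dP _ _ n) => [j k kn|j|]; last 2 first.
  - by case: (nP j).
  - apply: (@le_trans _ _ (\sum_j (2 * r (x j) + e))).
      by apply: ler_sum => j _; case: (nP j).
    rewrite big_split /= -mulr_sumr sumr_const -[e *+ _]mulr_natr.
    have : e * #|J|%:R <= 4^-1.
      rewrite /e mulrAC ler_pdivrMr; last by rewrite ltr_wpDl.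
      by rewrite ler_pM2l ?invr_gt0 // lerDl.
    by lra.
  have [Hx rE] := rH _ (rx j); have [_ nx _] := nP j.
  apply: le_trans d'd; apply: Vn => //; apply: le_trans nx; rewrite rE.
  by rewrite ler_wpM2r // ler_nat.
pose P (g : R) (w : Re) := w = q g \/ exists a x, [/\ V a,
  g = rngM a x & w = 8 * r x].
have P_ge0 g w : P g w -> 0 <= w.
  by case=> [->|[a [x [_ _ ->]]]]; [exact: seminorm_ge0|rewrite mulr_ge0].
have PN g w : P g w -> P (- g) w.
  case=> [->|[a [x [Va -> ->]]]]; first by left; rewrite seminormN.
  by right; exists a, (- x); rewrite rngMN seminormN.
have P_total g : exists w, P g w by exists (q g); left.
have gP := gauge_seminorm P_ge0 PN P_total.
set q2 := gauge P in gP.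
have q2q x : q2 x <= q x.
  by apply: (gauge_le P_ge0 (n := 1)); apply: cost_generator; left.
have q2M a x : V a -> q2 (rngM a x) <= 8 * r x.
  move=> Va; apply: (gauge_le P_ge0 (n := 1)).
  by apply: cost_generator; right; exists a, x.
have q2c : continuous q2.
  apply: seminorm_continuous => // e e0.
  apply: filterS (seminorm_nbhs (seminorm0 qP) qc e0) => x /=.
  exact: le_lt_trans.
(* The generators of the first kind merge into one [y]; the products remain as a list to which
   [sumV] applies. *)
have costE n z c : cost P n z c -> exists y (l : seq (R * R)),
    [/\ z = y + \sum_(e <- l) rngM e.1 e.2, forall e, e \in l -> V e.1 &
        q y + \sum_(e <- l) 8 * r e.2 <= c].
  elim=> [|{}n g w x {}c Pg _ [y [l [-> lV lc]]]].
    exists 0, [::]; split; rewrite // !big_nil; first by rewrite addr0.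
    by rewrite (seminorm0 qP) addr0.
  case: Pg => [->|[a [z' [Va -> ->]]]].
    exists (g + y), l; split=> //; first exact: addrA.
    apply: le_trans (lerD (seminormD qP _ _) (lexx _)) _.
    by rewrite -addrA lerD2l.
  exists y, ((a, z') :: l); split=> [|e|]; rewrite ?big_cons ?addrA /=.
  - by rewrite [y + _]addrC.
  - by rewrite inE => /orP[/eqP -> //|/lV].
  - by rewrite [q y + _]addrC -addrA lerD2l.
have q2U z : q2 z < 1 -> U z.
  move=> /(gauge_lt P_total)[n [c [/costE[y [l [-> lV lc]]] c1]]].
  have lc1 := le_lt_trans lc c1.
  have sl0 : 0 <= \sum_(e <- l) 8 * r e.2 by apply: sumr_ge0 => e _;
    rewrite mulr_ge0.
  have qy : q y < 1 by have := seminorm_ge0 qP y; lra.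
  rewrite -[X in U X]/(y + _) -[X in y + X]opprK; apply: (proj1 (U1U _ _ _ _)).
    exact: qU1.
  apply: qU1; rewrite /= seminormN //.
  rewrite (big_nth (0, 0)) big_mkord; apply: sumV => [j|].
    by apply: lV; rewrite mem_nth.
  rewrite -mulr_sumr (big_nth (0, 0)) big_mkord in lc1 sl0.
  by have := seminorm_ge0 qP y; lra.
pose p x := r x + q2 x.
have pP : group_seminorm p.
  split=> [|x|x y]; rewrite /p.
  - by rewrite (seminorm0 rP) (seminorm0 gP) addr0.
  - by rewrite (seminormN rP) (seminormN gP).
  - by rewrite addrACA lerD ?(seminormD rP) ?(seminormD gP).
have pc : continuous p by move=> x; apply: cvgD; [exact: rc|exact: q2c].
(* [2 * #|I|%:R * M] bounds the sum of the [r (x j)]; the factors [2 * C + 1] and 8 pass to products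
   under [r] and [q2], and the final 1 makes the constant positive. The radius 1/2 keeps partial
   sums where [r] equals [s]. *)
exists p, V, ((2 * C + 1 + 8) * (2 * #|I|%:R) + 1), 2^-1; split=> //.
- exact: is_seminormP.
- by rewrite ltr_wpDl // !mulr_ge0 // !addr_ge0 // mulr_ge0.
split=> [x /= px|J x a Va].
  by apply: q2U; have := r_ge0 x; rewrite /p in px; lra.
set M := max_partial_norm p x => M2.
have M0 : 0 <= M := max_partial_norm_ge0 p x.
have rM (E : {set J}) : r (\sum_(j in E) x j) <= M.
  apply: le_trans (max_partial_norm_ge p x E).
  by rewrite /p lerDl (seminorm_ge0 gP).
have rx j : H (x j).
  have [] // := rH (x j); have := rM [set j]%SET; rewrite big_set1.
  by move/le_lt_trans; apply; lra.
have sM (E : {set J}) : s (\sum_(j in E) x j) <= M.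
  have := rM E; have [|_ ->//] := rH (\sum_(j in E) x j).
  by apply: le_lt_trans (rM E) _; lra.
have sumr_x : \sum_j r (x j) <= 2 * #|I|%:R * M.
  apply: (@le_trans _ _ (\sum_j s (x j))).
    by apply: ler_sum => j _; exact: r_les.
  rewrite exchange_big /= mulrAC mulr_natr -sumr_const; apply: ler_sum => i _.
  apply: sum_norm_le_subsets => E; rewrite -thsum //; apply: le_trans (sM E).
  by rewrite /s (bigD1 i) //= lerDl; exact: sumr_ge0.
have q2sum : q2 (\sum_j rngM (a j) (x j)) <= 8 * \sum_j r (x j).
  apply: le_trans (seminorm_sum gP _ _ _) _.
  by rewrite mulr_sumr; apply: ler_sum => j _; exact: q2M.
have rsum : r (\sum_j rngM (a j) (x j)) <= (2 * C + 1) * \sum_j r (x j).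
  apply: le_trans (seminorm_sum rP _ _ _) _.
  by rewrite mulr_sumr; apply: ler_sum => j _; exact: rV.
rewrite mulrDl mul1r -mulrA.
apply: (@le_trans _ _ ((2 * C + 1 + 8) * \sum_j r (x j))).
  by rewrite /p mulrDl lerD.
by rewrite ler_wpDr // ler_wpM2l // !addr_ge0 // mulr_ge0.
Qed.
End LocallyCompact.

(** * The Hirsch property and function spaces *)

Lemma is_seminorm_group (Re : realType) (G : topologicalZmodType) (p : G -> Re)
  :
  is_seminorm p -> group_seminorm p.
Proof. by case=> _ _ p0 pN pD; split. Qed.

Section Hirsch.
Variables (Re : realType) (R : topologicalRngType).

(** A sum over [J] disjoint from [F0] is the difference of the sums over the union and over [F0],
    both close to the limit. *)
Lemma unconditional_tail (x : nat -> R) (U : set R) :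
  unconditionally_convergent x -> nbhs 0 U ->
  exists F0 : {fset nat}, forall J : {fset nat}, (forall n,
    n \in J -> n \notin F0) ->
    U (\sum_(n <- J) x n).
Proof.
move=> [l xl] U0; have [W W0 WU] := nbhs0_sub U0.
have [F0 F0P] := xl W W0; exists F0 => J JF0.
have sumU : \sum_(n <- (F0 `|` J)%fset) x n = \sum_(n <- F0) x n + \sum_(n <-
  J) x n.
  rewrite (big_fsetID _ (mem F0) (F0 `|` J)%fset); congr (_ + _);
    apply: eq_fbigl => n.
    by rewrite !inE /=; case: (n \in F0); rewrite ?andbF.
  rewrite !inE /=; have := JF0 n; case: (n \in J) => [/(_ isT) ->|_] //=.
    by rewrite orbT.
  by rewrite orbF andbN.
have -> : \sum_(n <- J) x n =
    (\sum_(n <- (F0 `|` J)%fset) x n - l) - (\sum_(n <- F0) x n - l).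
  by rewrite sumU opprB addrA subrK addrC addKr.
by apply: WU; apply: F0P => //; exact: fsubsetUl.
Qed.

Lemma seminormable_Hirsch : unconditionally_seminormable Re R -> Hirsch R.
Proof.
move=> usR x xc U /usR[p [V [C [e [pS V0 C0 e0 [pU pV]]]]]].
have pP := is_seminorm_group pS; have pc : continuous p by case: pS.
(* [eta] keeps partial sums of the tail within the radius [e] and makes [C * eta] at most
   [e / 2]. *)
pose eta := Num.min e (e / (2 * C)).
have eta0 : 0 < eta by rewrite lt_min e0 divr_gt0 // mulr_gt0.
have [F0 tail] := unconditional_tail xc (seminorm_nbhs (seminorm0 pP) pc eta0).
pose d := e / (2 * (#|` F0|%:R + 1)).
have d0 : 0 < d by rewrite divr_gt0 // mulr_gt0 // ltr_wpDl.
have cF0 : compact [set x n | n in [set` F0]].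
  by apply: finite_compact; apply: finite_image; exact: finite_fset.
have [W W0 WF0] := rngM_small cF0 (seminorm_nbhs (seminorm0 pP) pc d0).
exists (V `&` W) => [|F a aVW]; first exact: filterI.
apply: pU => /=; rewrite (bigID (mem F0)) /=.
apply: le_lt_trans (seminormD pP _ _) _.
have head : p (\sum_(n <- F | n \in F0) rngM (a n) (x n)) < e / 2.
  apply: le_lt_trans (seminorm_sum pP _ _ _) _.
  apply: (@le_lt_trans _ _ (#|` F0|%:R * d)).
    apply: (@le_trans _ _ (\sum_(n <- F | n \in F0) d)).
      rewrite big_seq_cond [leRHS]big_seq_cond;
        apply: ler_sum => n /andP[nF nF0].
      by apply/ltW/WF0; [have [] := aVW n nF|exists n].
    rewrite -big_filter big_const_seq count_predT iter_addr_0 mulr_natl.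
    rewrite ler_wpMn2l ?(ltW d0) //; apply: uniq_leq_size;
      first exact/filter_uniq/fset_uniq.
    by move=> n; rewrite mem_filter => /andP[].
  rewrite /d mulrA ltr_pdivrMr; last by rewrite mulr_gt0 // ltr_wpDl.
  by rewrite mulrA divfK // mulrC ltr_pM2l // ltrDl.
suff : p (\sum_(n <- F | n \notin F0) rngM (a n) (x n)) <= e / 2 by lra.
rewrite big_fset_condE big_seq_fsetE /=;
  set D := [fset n in F | n \notin F0]%fset.
have xM : max_partial_norm p (fun i : D => x (val i)) <= eta.
  apply: max_partial_norm_le; first exact: ltW.
  move=> E; pose P n := [exists i : D, (i \in E) && (val i == n)].
  have -> : \sum_(i in E) x (val i) = \sum_(i : D | P (val i)) x (val i).
    apply: eq_bigl => i; apply/idP/existsP =>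
      [iE|[j /andP[jE /eqP/val_inj <-//]]].
    by exists i; rewrite iE eqxx.
  rewrite -(big_seq_fsetE _ _ P) big_fset_condE; apply/ltW/tail => n.
  by rewrite !inE /= => /andP[/andP[]].
apply: le_trans (pV _ _ _ _ _) _.
- by move=> i; have [] := aVW (val i); first by have := valP i;
  rewrite !inE => /andP[].
- by apply: le_trans xM _; rewrite ge_min lexx.
- rewrite mulrC -ler_pdivlMr //; apply: le_trans xM _.
  by rewrite ge_min -mulrA -invfM lexx orbT.
Qed.
End Hirsch.

(** * Suprema of seminorms over compact sets *)

Section FunctionSpace.
Variables (Re : realType) (X : topologicalType) (K : set (set X)).
Variables (KH : ideal_of_compact_Hausdorff_subspaces K) (R :
  topologicalRngType).
Local Notation CKR := (CK KH R).

Lemma ideal_setU A B : K A -> K B -> K (A `|` B).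
Proof.
case: KH => -[_ Kc] _ KA KB; apply: (Kc A B) => //.
by apply/closed_subspaceP; exists setT; [exact: closedT|rewrite setTI setIid].
Qed.

Lemma CK_sumE (J : Type) (s : seq J) (P : pred J) (f : J -> CKR) (x : X) :
  (\sum_(j <- s | P j) f j : CKR) x = \sum_(j <- s | P j) f j x.
Proof. by elim/big_rec2: _ => // j y g _ <-. Qed.

(* The empty set is treated separately because K itself may be empty. *)
Definition empty_or_member (A : set X) := A = set0 \/ K A.

Lemma empty_or_member_compact A : empty_or_member A -> compact A.
Proof. by case=> [->|KA]; [exact: compact0|case: KH => -[Kc _] _;
  exact: Kc]. Qed.

Lemma nbhs_CK0 (A : set X) (W : set R) : empty_or_member A -> nbhs 0 W ->
  nbhs (0 : CKR) [set f : CKR | forall x, A x -> W (f x)].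
Proof.
move=> [->|KA] W0; first by apply: filterS filterT => f _ x [].
have W0' : W° 0 by [].
have := @CK_nbhs X K KH R 0 A W° KA (@open_interior _ W).
have A0 : (0 : CKR) @` A `<=` W° by move=> _ [x _ <-].
move=> /(_ A0); apply: filterS => f /= fA x Ax.
by apply: interior_subset; apply: fA; exists x.
Qed.

(** A finite intersection of subbasic sets around 0 is refined by taking the union of the compact
    sets and the intersection of the open ones. *)
Lemma nbhs_CK0P (U : set CKR) : nbhs 0 U -> exists A W,
  [/\ empty_or_member A, nbhs 0 W & [set f : CKR | forall x,
    A x -> W (f x)] `<=` U].
Proof.
move=> [B [[D DB <-] [i Di i0] BU]].
have [E ED Ei] := DB _ Di.
have : forall j, j \in (E : seq _) -> [/\ K j.1,
  open j.2 & (0 : CKR) @` j.1 `<=` j.2].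
  move=> j jE; have /set_mem [KA oU] := ED _ jE; split=> //.
  by move: i0; rewrite -Ei; apply.
move=> Ej; suff [A [W [AK W0 AW]]] : exists A W, [/\ empty_or_member A,
  nbhs 0 W &
    forall f : CKR, (forall x, A x -> W (f x)) ->
    forall j, j \in (E : seq _) -> f @` j.1 `<=` j.2].
  exists A, W; split=> // f fA; apply: BU; exists i => //.
  suff : i f by [].
  by rewrite -Ei => j jE; exact: (AW f fA j jE).
elim: (E : seq _) Ej => [|[A0 U0] l IH] lP.
  by exists set0, setT; split=> //; [left|exact: filterT].
have [|A [W [AK W0 AW]]] := IH; first by move=> j jl; apply: lP;
  rewrite inE jl orbT.
have [KA0 oU0 AU0] := lP (A0, U0) (mem_head _ _).
(* A subbasic set with empty [A0] is skipped: it imposes no condition, and its [U0] need not contain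
   0. *)
have [A0e|] := eqVneq A0 set0; last move=> /set0P[x0 A0x0].
  exists A, W; split=> // f fA j; rewrite inE => /orP[/eqP ->|]; last exact: AW.
    by move=> y [x] /=; rewrite A0e.
exists (A0 `|` A), (U0 `&` W); split.
- by right; case: AK => [->|KA]; [rewrite setU0|exact: ideal_setU].
- apply: filterI => //; apply: open_nbhs_nbhs; split=> //.
  by apply: AU0; exists x0.
- move=> f fA j; rewrite inE => /orP[/eqP -> _ [x A0x <-]|jl].
    by have [] := fA x (or_introl A0x).
  by apply: AW jl => x Ax; have [] := fA x (or_intror Ax).
Qed.

Section SupSeminorm.
Variables (A : set X) (p : R -> Re).
Hypotheses (AK : empty_or_member A) (pP : group_seminorm p) (pc : continuous p).

(** The value 0 is included so that the set is nonempty even when [A] is empty. *)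
Definition sup_seminorm (f : CKR) : Re := sup [set c | c = 0 \/ exists2 x,
  A x & c = p (f x)].

Lemma sup_seminorm_le (f : CKR) M : 0 <= M -> (forall x,
  A x -> p (f x) <= M) -> sup_seminorm f <= M.
Proof.
move=> M0 fM; apply: ge_sup; first by exists 0; left.
by move=> _ [->//|[x Ax ->]]; exact: fM.
Qed.

Lemma sup_seminorm_has_ubound (f : CKR) :
  has_ubound [set c | c = 0 \/ exists2 x, A x & c = p (f x)].
Proof.
have /compact_near_coveringP cA := empty_or_member_compact AK.
have : \forall M \near +oo, A `<=` (fun x => p (f x) <= M).
  apply: cA => x _; exists ([set y | p (f y) < p (f x) + 1],
    [set M | p (f x) + 1 < M]) => /=.
    split; last by apply: nbhs_pinfty_gt; rewrite num_real.
    have fc : {for x, continuous (p \o f)}.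
      by apply: continuous_comp; [exact: CK_continuous|exact: pc].
    move/cvgrPdist_lt : fc => /(_ 1 ltr01); apply: filterS => y /=.
    by rewrite ltr_norml => /andP[h1 h2]; lra.
  by move=> [y M] /= [h1 h2]; rewrite ltW // (lt_trans h1).
move=> /(filterI (nbhs_pinfty_ge (num_real (0 : Re)))) /filter_ex[M [M0 AM]].
by exists M => _ [-> //|[x Ax ->]]; exact: AM.
Qed.

Lemma sup_seminorm_ge (f : CKR) x : A x -> p (f x) <= sup_seminorm f.
Proof. by move=> Ax; apply: ub_le_sup (sup_seminorm_has_ubound f) _ _; right;
  exists x. Qed.

Lemma sup_seminorm_ge0 (f : CKR) : 0 <= sup_seminorm f.
Proof. by apply: ub_le_sup (sup_seminorm_has_ubound f) _ _; left. Qed.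

Lemma sup_seminormP : group_seminorm sup_seminorm.
Proof.
split=> [|f|f g].
- apply/eqP; rewrite eq_le sup_seminorm_ge0 andbT;
  apply: sup_seminorm_le => // x _.
  by rewrite [X in p X](_ : _ = 0) // (seminorm0 pP).
- suff h g : sup_seminorm (- g) <= sup_seminorm g.
    by apply/eqP; rewrite eq_le h /= -{1}[f]opprK h.
  apply: sup_seminorm_le => [|x Ax]; first exact: sup_seminorm_ge0.
  by rewrite (seminormN pP) sup_seminorm_ge.
- apply: sup_seminorm_le => [|x Ax];
  first by rewrite addr_ge0 ?sup_seminorm_ge0.
  by apply: le_trans (seminormD pP _ _) _; rewrite lerD ?sup_seminorm_ge.
Qed.

Lemma sup_seminorm_continuous : continuous sup_seminorm.
Proof.
apply: (seminorm_continuous sup_seminormP) => e e0.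
have e20 : 0 < e / 2 by rewrite divr_gt0.
apply: filterS (nbhs_CK0 AK (seminorm_nbhs (seminorm0 pP) pc e20)) => f /= fA.
apply: (@le_lt_trans _ _ (e / 2)); last lra.
by apply: sup_seminorm_le => [|x /fA]; exact: ltW.
Qed.
End SupSeminorm.

(** The estimate in [R] applies at each point of [A] with the same [C] and [e], since the seminorms
    of partial sums at a point are bounded by their suprema over [A]. *)
Lemma CK_seminormable : unconditionally_seminormable Re R ->
  unconditionally_seminormable Re CKR.
Proof.
move=> usR U /nbhs_CK0P[A [W [AK W0 AU]]].
have [p [V [C [e [pS V0 C0 e0 [pW pV]]]]]] := usR W W0.
have pP := is_seminorm_group pS; have pc : continuous p by case: pS.
have qP := sup_seminormP AK pP pc.
exists (sup_seminorm A p), [set f : CKR | forall x, A x -> V (f x)], C, e;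
  split=> //.
- exact: is_seminormP qP (sup_seminorm_continuous AK pP pc).
- exact: nbhs_CK0.
split=> [f /= fe|J f a aV Me].
  by apply: AU => x Ax; apply: pW;
    exact: le_lt_trans (sup_seminorm_ge AK pc f Ax) fe.
apply: sup_seminorm_le => [|x Ax];
  first by rewrite mulr_ge0 ?(ltW C0) // max_partial_norm_ge0.
have xM : max_partial_norm p (fun j =>
  f j x) <= max_partial_norm (sup_seminorm A p) f.
  apply: max_partial_norm_le => [|E]; first exact: max_partial_norm_ge0.
  rewrite -CK_sumE; apply: le_trans (sup_seminorm_ge AK pc _ Ax) _.
  exact: max_partial_norm_ge.
rewrite CK_sumE; apply: le_trans (pV _ _ _ _ _) _.
- by move=> j; exact: aV.
- exact: le_trans xM Me.
- by rewrite ler_pM2l.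
Qed.
End FunctionSpace.

Theorem theorem5p4 (Re : realType) (X : topologicalType) (K : set (set X))
    (KH : ideal_of_compact_Hausdorff_subspaces K) (R : topologicalRngType) :
  unconditionally_seminormable Re R \/ locally_compact_space R ->
  unconditionally_seminormable Re (CK KH R) /\ Hirsch (CK KH R).
Proof.
move=> usR; have {}usR : unconditionally_seminormable Re R.
  by case: usR => // /(@locally_compact_seminormable Re).
have usC := @CK_seminormable Re X K KH R usR.
by split=> //; exact: seminormable_Hirsch usC.
Qed.
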